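(* Let $L$ be an even lattice in the non-degenerate rational quadratic space $V$, let $U\subseteq V$ be an isotropic subspace, $I=U\cap L$, let $\tilde I\subseteq L^*$ be a sublattice whose pairing with $I$ is unimodular, and let $\tilde U=\tilde I_{\mathbb{Q}}$. The element $A\in\mathcal{P}_{U}^{0}$ that is associated with the parameters $(M,\gamma,\psi,\eta)$ lies in $\Gamma_{L,I}$ if and only if the following conditions are satisfied: (i) $\gamma\in\Gamma_{\Lambda}$. (ii) $M$ is in $\mathrm{SL}(I_{L^{*}},I)$. In particular, $\mathrm{Id}_{U}-M:U/I_{L^{*}} \to U/I$ is well-defined. (iii) $\psi(\Lambda) \subseteq I$, and the induced map from $\Delta_{\Lambda}$ to $U/I$ equals the composition of $\iota^{*}:\Delta_{\Lambda} \to U/I_{L^{*}}$ with $\mathrm{Id}_{U}-M:U/I_{L^{*}} \to U/I$ from (ii). (iv) $\tilde{\eta}\in\mathrm{Hom}_{\mathbb{Q}}^{as}(\tilde{U},U)$ is $(\mathrm{Id}_{U}-M)\alpha\big(\mathrm{Id}_{\tilde{U}}-\widetilde{M^{*}}\big)+M\alpha-\alpha\widetilde{M^{*}}-\frac{\tilde{\psi}\widetilde{\psi^{*}}}{2}-\tilde{\kappa}$ for some $\kappa\in\mathrm{Hom}(I^{*},I)$. Moreover, $\gamma$ in condition (i) can be arbitrary, for every $M\in\mathrm{SL}(I_{L^{*}},I)$ as in condition (ii) there is some $\psi\in\mathrm{Hom}_{\mathbb{Q}}(W,U)$ satisfying condition (iii), and for every such $M$ and $\psi$ there exists $\eta\in\mathrm{Hom}_{\mathbb{Q}}^{as}(U^{*},U)$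 for which condition (iv) is fulfilled (and then $\eta$ is unique up to $\mathrm{Hom}^{as}(I^{*},I)$).
   Context: **Lattices.** $V$ is a finite-dimensional $\mathbb{Q}$-vector space with a non-degenerate symmetric bilinear form $(\cdot,\cdot)$; $v^2:=(v,v)$. $L\subseteq V$ is an even lattice: a finitely generated subgroup of full rank with $(\lambda,\lambda)\in2\mathbb{Z}$ for all $\lambda\in L$. $L^*=\{\nu\in V:(\nu,L)\subseteq\mathbb{Z}\}\supseteq L$. $U$ isotropic means $U\subseteq U^\perp$; $W=U^\perp/U$ with its induced non-degenerate form. Put $I=U\cap L$, $I_{L^*}=U\cap L^*$, $I^\perp_L=U^\perp\cap L$, $I^\perp_{L^*}=U^\perp\cap L^*$. Then $\Lambda=I^\perp_L/I\subseteq W$ is an even lattice, with dual $\Lambda^*=I^\perp_{L^*}/I_{L^*}\subseteq W$; $\Delta_\Lambda=\Lambda^*/\Lambda$ with its $\mathbb{Q}/\mathbb{Z}$-valued bilinear form. For vector spaces $X^*$ denotes the dual vector space; for lattices it denotes the $\mathbb{Z}$-dual. $\mathrm{Hom}$ groups between lattices are viewed inside the $\mathrm{Hom}_{\mathbb{Q}}$ of their $\mathbb{Q}$-spans. If $\psi(\Lambda)\subseteq I$, then the ''induced map'' $\Delta_\Lambda\to U/I$ is the one induced by $\psi|_{\Lambda^*}:\Lambda^*\to U$. **Groups.** $\mathcal{P}_U$ is the stabilizer of $U$ in $\mathrm{O}(V)$. $\mathrm{SO}^+(V_{\mathbb{R}})$ is the identity component of $\mathrm{O}(V_{\mathbb{R}})$;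 $\Gamma_L$ is the group of automorphisms of $L$ lying in $\mathrm{SO}^+(V_{\mathbb{R}})$ and acting trivially on $L^*/L$; $\Gamma_\Lambda$ is defined similarly for $\Lambda\subseteq W$. $\mathcal{P}^0_{U_{\mathbb{R}}}$ is the identity component of $\mathcal{P}_{U_{\mathbb{R}}}$, $\mathcal{P}^0_U=\mathcal{P}_U\cap\mathcal{P}^0_{U_{\mathbb{R}}}$, and $\Gamma_{L,I}=\mathcal{P}^0_{U_{\mathbb{R}}}\cap\Gamma_L$. $\mathrm{SL}(I)$ is the group of determinant 1 automorphisms of $I$, and $\mathrm{SL}(I_{L^*},I)=\{M\in\mathrm{SL}(I):u-Mu\in I\ \forall u\in I_{L^*}\}$. **Complement and coordinates.** The pairing of $\tilde I\subseteq L^*$ with $I$ is unimodular if the map $\tilde I\to I^*=\mathrm{Hom}(I,\mathbb{Z})$ induced by the (integral) pairing is an isomorphism. $\tilde U=\tilde I_{\mathbb{Q}}$ is then a complement of $U^\perp$ in $V$. The pairing identifies $\tilde U\cong V/U^\perp\cong U^*$, and $\tilde W:=(U\oplus\tilde U)^\perp\cong W$, so $V=U\oplus\tilde W\oplus\tilde U$. A tilde ($\tilde\psi,\tilde\gamma,\tilde\eta,\tilde\kappa,\widetilde{\psi^*},\widetilde{M^*}$) denotes transport of maps through $W\cong\tilde W$, $U^*\cong\tilde U$, and $\tilde\Lambda\subseteq\tilde\Lambda^*\subseteq\tilde W$ are the images of $\Lambda\subseteq\Lambda^*$. For $\psi\in\mathrm{Hom}_{\mathbb{Q}}(W,U)$,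 $\psi^*:U^*\to W$ is its dual (using $W^*\cong W$), and $M^{-*}=(M^* )^{-1}$. $\mathrm{Hom}^{as}$ denotes the maps $\eta:U^*\to U$ (or $\tilde U\to U$) for which $(u^*,v^* )\mapsto(u^*,\eta v^* )$ is anti-symmetric; symmetric maps are defined similarly. $\alpha:\tilde U\to U$ is the unique symmetric map such that $\{\tilde u-\alpha\tilde u:\tilde u\in\tilde U\}$ is isotropic. Every $A\in\mathcal{P}_U$ corresponds bijectively to parameters $(M,\gamma,\psi,\eta)\in\mathrm{GL}(U)\times\mathrm{O}(W)\times\mathrm{Hom}_{\mathbb{Q}}(W,U)\times\mathrm{Hom}^{as}_{\mathbb{Q}}(U^*,U)$ via $Au=Mu$ ($u\in U$), $Aw=\tilde\gamma w-\tilde\psi\tilde\gamma w$ ($w\in\tilde W$), and, for $\tilde u\in\tilde U$, $$A\tilde u=\widetilde{M^{-*}}\tilde u+\widetilde{\psi^*}\widetilde{M^{-*}}\tilde u+\Big(M\alpha\tilde u-\alpha\widetilde{M^{-*}}\tilde u-\tfrac12\tilde\psi\widetilde{\psi^*}\widetilde{M^{-*}}\tilde u-\tilde\eta\widetilde{M^{-*}}\tilde u\Big);$$ $A\in\mathcal{P}^0_U$ means that $\det M>0$ and $\gamma\in\mathrm{O}(W)\cap\mathrm{SO}^+(W_{\mathbb{R}})$. **The map $\iota$.** Put $\tilde I_L=\{\mu\in\tilde I:\exists\nu\in L\ \forall\lambda\in I,\ (\mu,\lambda)=(\nu,\lambda)\}$. It pairs unimodularly with $I_{L^*}$, so $\mathrm{Hom}(\tilde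 I_L,\mathbb{Q}/\mathbb{Z})\cong U/I_{L^*}$. There is a unique homomorphism $\iota:\tilde I_L\to\Delta_\Lambda$ such that whenever $u+w+\tilde u\in L$ with $u\in U$, $w\in\tilde W$, $\tilde u\in\tilde U$, one has $\tilde u\in\tilde I_L$, $w\in\tilde\Lambda^*$ and $w+\tilde\Lambda=\iota\tilde u$ (using $\tilde\Lambda^*/\tilde\Lambda\cong\Delta_\Lambda$). Its $\mathbb{Q}/\mathbb{Z}$-dual is $\iota^*:\Delta_\Lambda\to U/I_{L^*}$, $(\iota^*\delta,\tilde u)=(\delta,\iota\tilde u)\in\mathbb{Q}/\mathbb{Z}$. *)

(* Defs.v *)
From HB Require Import structures.
From mathcomp Require Import all_boot all_order all_algebra.
From mathcomp Require Import sesquilinear.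
From mathcomp Require Import all_classical all_reals all_analysis.
Import numFieldNormedType.Exports.

Set Implicit Arguments.
Unset Strict Implicit.
Unset Printing Implicit Defensive.

Import Order.TTheory GRing.Theory Num.Theory.
Local Open Scope classical_set_scope.
Local Open Scope ring_scope.

Section QuotientVectorSpace.
Variables (K : fieldType) (vT : vectType K) (X : {vspace vT}).

Definition quotv : Type := Quotient.quot (pred_of_vspace X).
HB.instance Definition _ := Choice.on quotv.
HB.instance Definition _ := GRing.Zmodule.on quotv.

Definition quotv_pi (v : vT) : quotv :=
  (\pi_(Quotient.quot (pred_of_vspace X)) v)%qT.
Definition quotv_repr (x : quotv) : vT := repr x.

Lemma quotv_reprK : cancel quotv_repr quotv_pi.
Proof. exact: reprK. Qed.

Lemma quotv_eqP u v : reflect (quotv_pi u = quotv_pi v) (u - v \in X).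
Proof. by rewrite Quotient.idealrBE; apply: eqP. Qed.

Lemma quotv_repr_pi u : quotv_repr (quotv_pi u) - u \in X.
Proof. by apply/quotv_eqP; rewrite quotv_reprK. Qed.

Fact quotv_pi_is_zmod_morphism : zmod_morphism quotv_pi.
Proof. by move=> u v; rewrite /quotv_pi !piE. Qed.
HB.instance Definition _ :=
  GRing.isZmodMorphism.Build vT quotv quotv_pi quotv_pi_is_zmod_morphism.

Definition quotv_scale (a : K) (x : quotv) : quotv :=
  quotv_pi (a *: quotv_repr x).

Lemma quotv_scale_pi a u : quotv_scale a (quotv_pi u) = quotv_pi (a *: u).
Proof. by apply/quotv_eqP; rewrite -scalerBr rpredZ ?quotv_repr_pi. Qed.

Fact quotv_scaleA a b x :
  quotv_scale a (quotv_scale b x) = quotv_scale (a * b) x.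
Proof. by rewrite -[x]quotv_reprK !quotv_scale_pi scalerA. Qed.
Fact quotv_scale1 : left_id 1 quotv_scale.
Proof. by move=> x; rewrite -[x]quotv_reprK quotv_scale_pi scale1r. Qed.
Fact quotv_scaleDr : right_distributive quotv_scale +%R.
Proof.
move=> a x y; rewrite -[x]quotv_reprK -[y]quotv_reprK -raddfD !quotv_scale_pi.
by rewrite -raddfD scalerDr.
Qed.
Fact quotv_scaleDl x : {morph quotv_scale^~ x : a b / a + b}.
Proof.
by move=> a b; rewrite -[x]quotv_reprK !quotv_scale_pi -raddfD scalerDl.
Qed.
HB.instance Definition _ := GRing.Zmodule_isLmodule.Build K quotv
  quotv_scaleA quotv_scale1 quotv_scaleDr quotv_scaleDl.

Fact quotv_pi_is_scalable : scalable quotv_pi.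
Proof. by move=> a u; rewrite -quotv_scale_pi. Qed.
HB.instance Definition _ :=
  GRing.isScalable.Build K vT quotv *:%R quotv_pi quotv_pi_is_scalable.

Fact quotv_vect_iso : Vector.axiom (\dim X^C) quotv.
Proof.
pose q (x : quotv) := quotv_repr x - projv X (quotv_repr x).
have qC x : q x \in X^C%VS by apply: memv_projC.
have qpi u : q (quotv_pi u) = u - projv X u.
  rewrite /q; apply/eqP; rewrite subr_eq addrAC eq_sym subr_eq eq_sym; apply/eqP.
  have /projv_id := quotv_repr_pi u; rewrite linearB /= => /eqP.
  by rewrite subr_eq addrAC eq_sym subr_eq => /eqP ->; rewrite addrC.
have qlin : linear q.
  move=> a x y; rewrite -[x]quotv_reprK -[y]quotv_reprK -linearP !qpi linearP /=.
  by rewrite scalerBr opprD addrACA.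
exists (fun x => \row_i coord (vbasis X^C) i (q x)).
  by move=> a x y; apply/rowP=> i; rewrite !mxE qlin linearP.
exists (fun r : 'rV_(\dim X^C) => quotv_pi (\sum_i r 0 i *: (vbasis X^C)`_i)).
  move=> x; rewrite -[RHS]quotv_reprK; apply/quotv_eqP.
  under eq_bigr do rewrite mxE.
  by rewrite -coord_vbasis // /q addrAC subrr add0r memvN memv_proj.
move=> r; apply/rowP=> i; rewrite mxE qpi.
set v := \sum_i _; have vC : v \in X^C%VS.
  by apply: rpred_sum => j _; rewrite rpredZ ?vbasis_mem ?memt_nth.
have -> : projv X v = 0.
  have := daddv_pi_add (capv_compl X) (w := v).
  rewrite addv_complf memvf => /(_ isT).
  by rewrite [daddv_pi X^C X v]daddv_pi_id 1?capvC ?capv_compl // -[RHS]add0r => /addIr.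
by rewrite subr0 coord_sum_free // (basis_free (vbasisP _)).
Qed.
HB.instance Definition _ := Lmodule_hasFinDim.Build K quotv quotv_vect_iso.

End QuotientVectorSpace.

Notation dualv vT := ('Hom(vT, rat^o)).

Section DualMap.
Variables aT rT : vectType rat.

Definition dual_fun (f : 'Hom(aT, rT)) (g : dualv rT) : dualv aT := (g \o f)%VF.

Fact dual_fun_is_linear f : linear (dual_fun f).
Proof. by move=> a g h; rewrite /dual_fun comp_lfunDl -comp_lfunZl. Qed.
HB.instance Definition _ f :=
  GRing.isLinear.Build rat (dualv rT) (dualv aT) *:%R (dual_fun f)
    (dual_fun_is_linear f).

Definition dual_map (f : 'Hom(aT, rT)) : 'Hom(dualv rT, dualv aT) :=
  linfun (dual_fun f).

Lemma dual_mapE f g x : dual_map f g x = g (f x).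
Proof. by rewrite lfunE /= comp_lfunE. Qed.

End DualMap.

Section FormToDual.
Variables (vT : vectType rat) (b : {symmetric vT}).

Definition to_dual_fun (v : vT) : dualv vT := linfun (b v : vT -> rat^o).

Fact to_dual_fun_is_linear : linear to_dual_fun.
Proof.
move=> a u v; apply/lfunP=> x; rewrite add_lfunE scale_lfunE !lfunE /=.
by rewrite linearPl.
Qed.
HB.instance Definition _ :=
  GRing.isLinear.Build rat vT (dualv vT) *:%R to_dual_fun to_dual_fun_is_linear.

Definition to_dual : 'Hom(vT, dualv vT) := linfun to_dual_fun.

Lemma to_dualE v x : to_dual v x = b v x.
Proof. by rewrite !lfunE. Qed.

End FormToDual.

Section Lattices.
Variables (vT : vectType rat) (b : {symmetric vT}).
Implicit Types A L : set vT.

Definition fg_subgroup A :=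
  exists (m : nat) (s : m.-tuple vT), A = [set v | inIntSpan s v].

Definition Qspan A : {vspace vT} :=
  xget 0%VS [set S : {vspace vT} | A `<=` [set` S] /\
    forall T : {vspace vT}, A `<=` [set` T] -> (S <= T)%VS].

Definition even_lattice L :=
  [/\ fg_subgroup L, Qspan L = fullv &
      forall v, L v -> exists k : int, b v v = (k *+ 2)%:~R].

Definition dual_lattice L : set vT :=
  [set v | forall l, L l -> b v l \is a Num.int].

(* The elements of a quotient by [A] are represented by the cosets of [A]. *)
Definition cosetv A (v : vT) : set vT := [set v + a | a in A].

End Lattices.

(* If [f] maps the subgroup [A] into [B], this sends [v + A] to [f v + B]. *)
Definition coset_map (aT rT : vectType rat) (B : set rT) (f : aT -> rT)
  (C : set aT) : set rT := \bigcup_(c in C) cosetv B (f c).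

Section QspanTheory.
Variable vT : vectType rat.
Implicit Types A : set vT.

Lemma QspanP A : A `<=` [set` Qspan A] /\
  forall T : {vspace vT}, A `<=` [set` T] -> (Qspan A <= T)%VS.
Proof.
rewrite /Qspan; case: xgetP => [S _ //|noS]; exfalso.
have step n : exists s : seq vT, {in s, forall x, A x} /\ (n <= \dim (span s))%N.
  elim: n => [|n [s [sA ns]]]; first by exists [::].
  have [sub|] := pselect (A `<=` [set` span s]).
    case: (noS (span s)); split=> // T AT; apply/span_subvP => x xs.
    exact/AT/sA.
  move/existsNP => [v /not_implyP[Av /negP vs]].
  exists (v :: s); split.
    by move=> x; rewrite inE => /orP[/eqP->//|/sA].
  apply: leq_ltn_trans ns _.
  have sub : (span s <= span (v :: s))%VS by rewrite span_cons addvSr.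
  rewrite ltn_neqAle dimvS // andbT; apply/negP => /eqP e.
  have E : span s = span (v :: s) by apply/eqP; rewrite eqEdim sub e /=.
  by apply/negP: vs; rewrite negbK E span_cons memvE addvSl.
have [s [_]] := step (\dim {:vT}).+1.
by rewrite ltnNge dimvS ?subvf.
Qed.

End QspanTheory.

(* [V_R] is the row space ['rV[R]_n] of coordinates in the basis
   [vbasis fullv]; an endomorphism acts by right multiplication by its matrix. *)
Section RealPoints.
Variables (R : realType) (vT : vectType rat) (b : {symmetric vT}).
Local Notation n := (\dim {:vT}).
Local Notation e := (vbasis {:vT}).

Definition real_mx (A : 'End(vT)) : 'M[R]_n := map_mx ratr (passmx.mxof e e A).

Definition real_gram : 'M[R]_n := \matrix_(i, j) ratr (b e`_i e`_j).

(* The row space of this matrix is [U_R]. *)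
Definition real_subspace (U : {vspace vT}) : 'M[R]_n :=
  map_mx ratr (passmx.msof e U).

Definition O_R : set 'M[R]_n :=
  [set g | g *m real_gram *m g^T = real_gram].

Definition SOplus_R : set 'M[R]_n := connected_component O_R 1%:M.

Definition P_R (U : {vspace vT}) : set 'M[R]_n :=
  [set g | O_R g /\ (real_subspace U *m g == real_subspace U)%MS].

Definition P0_R (U : {vspace vT}) : set 'M[R]_n :=
  connected_component (P_R U) 1%:M.

Definition O_Q : set 'End(vT) := [set A : 'End(vT) | isometry b b A].

Definition P_Q (U : {vspace vT}) : set 'End(vT) :=
  [set A : 'End(vT) | O_Q A /\ (A @: U)%VS = U].

Definition P0_Q (U : {vspace vT}) : set 'End(vT) :=
  [set A : 'End(vT) | P_Q U A /\ P0_R U (real_mx A)].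

Definition Gamma (L : set vT) : set 'End(vT) :=
  [set A : 'End(vT) | [/\ O_Q A, A @` L = L, SOplus_R (real_mx A) &
             forall v, dual_lattice b L v -> L (A v - v)]].

Definition Gamma_stab (L : set vT) (U : {vspace vT}) : set 'End(vT) :=
  [set A : 'End(vT) | P0_R U (real_mx A) /\ Gamma L A].

End RealPoints.

Section SpecialLinear.
Variable vT : vectType rat.

Definition lfun_det (M : 'End(vT)) : rat :=
  \det (passmx.mxof (vbasis {:vT}) (vbasis {:vT}) M).

Definition SL (I : set vT) : set 'End(vT) :=
  [set M : 'End(vT) | M @` I = I /\ lfun_det M = 1].

Definition SLrel (J I : set vT) : set 'End(vT) :=
  [set M : 'End(vT) | SL I M /\ forall u, J u -> I (u - M u)].

End SpecialLinear.

Section ReducedSpace.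
Variables (V : vectType rat) (b : {symmetric V}) (U : {vspace V}).

Definition redspace : vectType rat :=
  quotv (linfun (@vsval _ _ (orthov b U)) @^-1: U)%VS.

Local Notation Uperp := (orthov b U).
Local Notation UinUperp := (linfun (@vsval _ _ Uperp) @^-1: U)%VS.

(* The projection U^perp -> U^perp / U, extended to V by [vsproj]; only its
   values on U^perp are meaningful. *)
Definition red_proj : 'Hom(V, redspace) :=
  linfun (quotv_pi UinUperp \o vsproj Uperp).

Lemma red_projE v : red_proj v = quotv_pi UinUperp (vsproj Uperp v).
Proof. by rewrite lfunE. Qed.

Lemma red_proj_surj (x : redspace) : exists2 v, v \in Uperp & red_proj v = x.
Proof.
exists (vsval (quotv_repr x)); first exact: subvsP.
by rewrite red_projE vsvalK quotv_reprK.
Qed.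

Lemma red_proj_eq0 v : v \in Uperp -> (red_proj v == 0) = (v \in U).
Proof.
move=> vUp; rewrite red_projE -(raddf0 (quotv_pi UinUperp)).
rewrite (sameP eqP (quotv_eqP _ _ _)) subr0 -memv_preim lfunE /=.
by rewrite vsprojK.
Qed.

Definition redform (x y : redspace) : rat :=
  b (vsval (quotv_repr x)) (vsval (quotv_repr y)).

Lemma redformE u v : u \in Uperp -> v \in Uperp ->
  redform (red_proj u) (red_proj v) = b u v.
Proof.
have aux w : w \in Uperp ->
    exists2 w', w' \in U & vsval (quotv_repr (red_proj w)) = w + w'.
  move=> wUp; rewrite red_projE; set x := quotv_repr _.
  exists (vsval x - w); last by rewrite addrC subrK.
  have := quotv_repr_pi UinUperp (vsproj Uperp w).
  by rewrite -memv_preim lfunE raddfB /= vsprojK.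
move=> uUp vUp; rewrite /redform.
have [u' u'U eu] := aux u uUp; have [v' v'U ev] := aux v vUp.
have uu'U : u + u' \in Uperp by rewrite -eu subvsP.
have e1 : b (u + u') v' = 0 by move/mem_orthovP: uu'U; apply.
have e2 : b v u' = 0 by move/mem_orthovP: vUp; apply.
have Dr x y z : b x (y + z) = b x y + b x z by exact: linearDr.
have Dl x y z : b (x + y) z = b x z + b y z by exact: linearDl.
by rewrite eu ev Dr e1 addr0 Dl [b u' v]hermC e2 /= mulr0 addr0.
Qed.

Fact redform_is_bilinear :
  bilinear_for (GRing.Scale.Law.clone _ _ *%R _)
    (GRing.Scale.Law.clone _ _ (idfun \; *%R) _) redform.
Proof.
have sur := red_proj_surj.
split=> z a x y /=; move: (sur x) (sur y) (sur z).
  move=> [u uU <-] [v vU <-] [w wU <-].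
  by rewrite -linearP !redformE ?rpredD ?rpredZ // linearPl.
move=> [u uU <-] [v vU <-] [w wU <-].
by rewrite -linearP !redformE ?rpredD ?rpredZ // linearPr.
Qed.
HB.instance Definition _ :=
  bilinear_isBilinear.Build rat redspace redspace rat *%R (idfun \; *%R)
    redform redform_is_bilinear.

Fact redform_sym x y : redform x y = (-1) ^+ false * idfun (redform y x).
Proof. by rewrite /redform hermC. Qed.
HB.instance Definition _ :=
  isHermitianSesquilinear.Build rat redspace false idfun redform redform_sym.

Definition redlattice (L : set V) : set redspace :=
  red_proj @` ([set` Uperp] `&` L).

End ReducedSpace.
Arguments redform {V} b U x y.
Arguments redlattice {V} b U L _.

Section Coordinates.
Variables (V : vectType rat) (b : {symmetric V}) (U Ut : {vspace V}).

Local Notation W := (redspace b U).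
Local Notation bW := (redform b U : {symmetric W}).
Local Notation Us := (dualv (subvs_of U)).

Definition Wt : {vspace V} := orthov b (U + Ut)%VS.

Definition pairU : 'Hom(V, Us) :=
  (dual_map (linfun (@vsval _ _ U)) \o to_dual b)%VF.

Lemma pairUE v u : pairU v u = b v (vsval u).
Proof. by rewrite comp_lfunE dual_mapE to_dualE lfunE. Qed.

(* The identifications of [Ut] with [U^*], and of [Wt] with [W]; they are
   bijective when [Ut] pairs perfectly with [U]. *)
Definition idU : 'Hom(subvs_of Ut, Us) := (pairU \o linfun (@vsval _ _ Ut))%VF.
Definition idW : 'Hom(subvs_of Wt, W) :=
  (red_proj b U \o linfun (@vsval _ _ Wt))%VF.

Definition tilde_UsUs (h : 'End(Us)) : 'End(subvs_of Ut) :=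
  (idU^-1 \o h \o idU)%VF.
Definition tilde_UsU (h : 'Hom(Us, subvs_of U)) : 'Hom(subvs_of Ut, subvs_of U) :=
  (h \o idU)%VF.
Definition tilde_UsW (h : 'Hom(Us, W)) : 'Hom(subvs_of Ut, subvs_of Wt) :=
  (idW^-1 \o h \o idU)%VF.
Definition tilde_WW (h : 'End(W)) : 'End(subvs_of Wt) :=
  (idW^-1 \o h \o idW)%VF.
Definition tilde_WU (h : 'Hom(W, subvs_of U)) : 'Hom(subvs_of Wt, subvs_of U) :=
  (h \o idW)%VF.

Definition psi_dual (psi : 'Hom(W, subvs_of U)) : 'Hom(Us, W) :=
  ((to_dual bW)^-1 \o dual_map psi)%VF.

Definition antisymmetric_map (eta : 'Hom(Us, subvs_of U)) : Prop :=
  forall f g : Us, f (eta g) = - g (eta f).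

Definition is_alpha (alpha : 'Hom(subvs_of Ut, subvs_of U)) : Prop :=
  (forall x y, b (vsval x) (vsval (alpha y)) = b (vsval y) (vsval (alpha x))) /\
  (forall x y, b (vsval x - vsval (alpha x)) (vsval y - vsval (alpha y)) = 0).

Variable alpha : 'Hom(subvs_of Ut, subvs_of U).

Definition has_parameters (A : 'End(V)) (M : 'End(subvs_of U)) (gamma : 'End(W))
    (psi : 'Hom(W, subvs_of U)) (eta : 'Hom(Us, subvs_of U)) : Prop :=
  let tgamma := tilde_WW gamma in
  let tpsi := tilde_WU psi in
  let tpsis := tilde_UsW (psi_dual psi) in
  let teta := tilde_UsU eta in
  let tMinv := tilde_UsUs (dual_map M)^-1 in
  [/\ lker M = 0%VS, O_Q bW gamma & antisymmetric_map eta] /\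
  [/\ forall u, A (vsval u) = vsval (M u),
      forall w, A (vsval w) = vsval (tgamma w) - vsval (tpsi (tgamma w)) &
      forall u, A (vsval u) =
        vsval (tMinv u) + vsval (tpsis (tMinv u)) +
        vsval (M (alpha u) - alpha (tMinv u)
               - 2%:R^-1 *: tpsi (tpsis (tMinv u)) - teta (tMinv u))].

Variables L It : set V.

Definition latI : set (subvs_of U) := [set u | L (vsval u)].
Definition latI_dualL : set (subvs_of U) := [set u | dual_lattice b L (vsval u)].

(* Hom(I, Z), inside the dual of U, for a lattice I of full rank in U. *)
Definition hom_lattice (I : set (subvs_of U)) : set Us :=
  [set f | forall u, I u -> f u \is a Num.int].

Definition unimodular_pairing : Prop :=
  set_bij It (hom_lattice latI) pairU.

Definition ItL : set V :=
  [set mu | It mu /\ exists2 nu, L nu &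
     forall l, latI l -> b mu (vsval l) = b nu (vsval l)].

(* [iota mu], for [mu] in [ItL], is a coset of [Lambda] in its dual. *)
Definition iota (mu : V) : set W :=
  [set x | exists (u : subvs_of U) (w : subvs_of Wt),
     L (vsval u + vsval w + mu) /\ x = idW w].

(* [iota_dual D], for a coset [D] of [Lambda] in its dual, is a coset of
   [latI_dualL] in U. *)
Definition iota_dual (D : set W) : set (subvs_of U) :=
  [set u | forall mu delta x, ItL mu -> D delta -> iota mu x ->
     b (vsval u) mu - redform b U delta x \is a Num.int].

Definition condition_psi (M : 'End(subvs_of U)) (psi : 'Hom(W, subvs_of U)) :=
  let Lambda := redlattice b U L in
  psi @` Lambda `<=` latI /\
  forall delta, dual_lattice bW Lambda delta ->
    coset_map latI psi (cosetv Lambda delta) =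
    coset_map latI (\1 - M)%VF (iota_dual (cosetv Lambda delta)).

Definition HomI : set 'Hom(Us, subvs_of U) :=
  [set kappa | kappa @` hom_lattice latI `<=` latI].

Definition condition_eta (M : 'End(subvs_of U)) (psi : 'Hom(W, subvs_of U))
    (eta : 'Hom(Us, subvs_of U)) : Prop :=
  let tpsi := tilde_WU psi in
  let tpsis := tilde_UsW (psi_dual psi) in
  let tMs := tilde_UsUs (dual_map M) in
  exists2 kappa, HomI kappa &
    tilde_UsU eta =
      ((\1 - M) \o alpha \o (\1 - tMs) + (M \o alpha) - (alpha \o tMs)
       - 2%:R^-1 *: (tpsi \o tpsis) - tilde_UsU kappa)%VF.

End Coordinates.
Arguments latI {V} U L _.
Arguments latI_dualL {V} b U L _.
Arguments HomI {V} U L _.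

(* Main.v *)
(* The complement [Ut] splits every vector as v = v_U + v_W + v_T.  The lattice
   [L] is its own double dual and [It] lies in [L^*] with unimodular pairing
   against [I]; hence [L^*] is the sum of [It] and of L^* /\ U^perp, and
   L /\ U^perp is the sum of [I] and of the image of [Lambda] in [Wt].  An
   isometry [A] preserves [L] and acts trivially on L^*/L if and only if A - 1
   maps [L^*] to [L].  On L^* /\ U^perp this gives (i)-(iii).  For mu in [It] put
   x = M^-* mu and v = x - mu; then (A - 1) mu is v + psi^* x - 2 alpha v plus
   kappa x, where kappa is defined by (iv).  The first part always pairs
   integrally with [L^*], so it lies in [L], and the condition is that kappa maps
   [It] to [I].  The norm of that first part is even, which says that the
   symmetric form to be cancelled by kappa is even on [It], so it is the
   symmetrization of an integral form: this yields eta.  The connected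
   components are controlled by the continuous maps sending an element of the
   real parabolic group to its determinant on U and to its action on W. *)

From HB Require Import structures.
Require Import Defs.
From mathcomp Require Import all_boot all_order all_algebra.
From mathcomp Require Import sesquilinear.
From mathcomp Require Import all_classical all_reals all_analysis.
From mathcomp Require Import ring.
Import numFieldNormedType.Exports.
Import Order.TTheory GRing.Theory Num.Theory.
Local Open Scope classical_set_scope.
Local Open Scope ring_scope.

Set Implicit Arguments.
Unset Strict Implicit.
Unset Printing Implicit Defensive.

(** * Finitely generated subgroups *)

(** The map iota is given by cosets, and [L] need not be the sum of its intersections with the three
    summands, so the data contain no linear lift of iota. The rational linear map [th] of
    [dual_lift] serves for the dual: [th w + w] lies in L^*, so [- th] represents iota^*. It turns
    (iii) into a membership, gives the witness [psi = (M - 1) th], and moves elements of Lambda^*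
    into L^*, where A - 1 can be applied to them. Topology enters only at the ends. Lying in P^0 is
    a hypothesis on [A], so the backward direction needs just that the component of the real
    parabolic lies in that of the orthogonal group. Forward, [M] preserves the lattice [I], so its
    determinant is 1 or -1 and only the sign has to be controlled. To replace [gamma'] by [gamma],
    [A] is composed with a map that moves only [Wt], and a connected set joining the two inside SO^+
    of [W] is carried into the real parabolic group. *)

Section IntegralSpan.

(** A recursive form of [inIntSpan], on sequences instead of tuples, so that one generator can be
    split off by induction. *)
Fixpoint Zspan (V : zmodType) (s : seq V) (v : V) : Prop :=
  if s is x :: s' then exists c : int, Zspan s' (v - x *~ c) else v = 0.

Lemma ZspanP (V : zmodType) m (s : m.-tuple V) v : Zspan s v <-> inIntSpan s v.
Proof.
elim: m s v => [|m IH] s v.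
  rewrite tuple0; split=> [->|[a ->]]; last by rewrite big_ord0.
  by exists [ffun=> 0]; rewrite big_ord0.
case/tupleP: s => x s /=; split.
  move=> [c /IH[a e]]; exists [ffun i => if unlift ord0 i is Some j then a j else c].
  rewrite big_ord_recl ffunE unlift_none /= -(subrK (x *~ c) v) e addrC.
  by congr (_ + _); apply: eq_bigr => i _; rewrite ffunE liftK.
move=> [a ->]; exists (a ord0); rewrite big_ord_recl /= addrAC subrr add0r.
by apply/IH; exists [ffun i => a (lift ord0 i)]; apply: eq_bigr => i _; rewrite ffunE.
Qed.

Lemma Zspan0 (V : zmodType) (s : seq V) : Zspan s 0.
Proof. by elim: s => //= x s IH; exists 0; rewrite mulr0z subr0. Qed.

Lemma ZspanD (V : zmodType) (s : seq V) u v :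
  Zspan s u -> Zspan s v -> Zspan s (u + v).
Proof.
elim: s u v => [u v -> ->|x s IH u v [c su] [d sv]] /=; first by rewrite addr0.
by exists (c + d); rewrite mulrzDr opprD addrACA; apply: IH.
Qed.

Lemma ZspanN (V : zmodType) (s : seq V) v : Zspan s v -> Zspan s (- v).
Proof.
elim: s v => [v ->|x s IH v [c sv]] /=; first by rewrite oppr0.
by exists (- c); rewrite mulrNz -opprD; apply: IH.
Qed.

Lemma ZspanM (V : zmodType) (s : seq V) v (c : int) : Zspan s v -> Zspan s (v *~ c).
Proof.
elim: s v => [v ->|x s IH v [d sv]] /=; first by rewrite mul0rz.
by exists (d * c); rewrite mulrzA -mulrzBl; apply: IH.
Qed.

Lemma Zspan_mem (V : zmodType) (s : seq V) v : v \in s -> Zspan s v.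
Proof.
elim: s => //= x s IH; rewrite inE => /orP[/eqP->|/IH sv].
  by exists 1; rewrite mulr1z subrr; apply: Zspan0.
by exists 0; rewrite mulr0z subr0.
Qed.

Lemma Zspan_min (V : zmodType) (s : seq V) (A : set V) :
    A 0 -> (forall u v, A u -> A v -> A (u + v)) -> (forall v, A v -> A (- v)) ->
  {in s, forall x, A x} -> Zspan s `<=` A.
Proof.
move=> A0 AD AN.
elim: s => [_ v -> //|x s IH sA v /= [c sv]].
rewrite -(subrK (x *~ c) v); apply: (AD).
  by apply: IH sv => y ys; apply: sA; rewrite inE ys orbT.
have Ax : A x by apply: sA; rewrite mem_head.
have An n : A (x *+ n) by elim: n => [|n IHn]; rewrite ?mulr0n // mulrS; exact: AD.
by case: c {sv} => n; [rewrite -pmulrn|rewrite NegzE mulrNz -pmulrn; apply: AN].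
Qed.

Lemma Zspan_map (V W : zmodType) (f : {additive V -> W}) (s : seq V) :
  Zspan (map f s) = f @` Zspan s.
Proof.
apply/seteqP; split.
  apply: Zspan_min.
  - by exists 0; [apply: Zspan0|rewrite raddf0].
  - move=> _ _ [u su <-] [v sv <-]; exists (u + v); rewrite ?raddfD //; exact: ZspanD.
  - move=> _ [u su <-]; exists (- u); rewrite ?raddfN //; exact: ZspanN.
  - by move=> _ /mapP[x xs ->]; exists x => //; apply: Zspan_mem.
move=> _ [v + <-]; apply: (@Zspan_min _ _ (fun v => Zspan (map f s) (f v))) v.
- by rewrite raddf0; apply: Zspan0.
- by move=> u v; rewrite raddfD; apply: ZspanD.
- by move=> u; rewrite raddfN; apply: ZspanN.
- by move=> x xs; apply/Zspan_mem/map_f.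
Qed.

Lemma Zspan_span (V : vectType rat) (s : seq V) v : Zspan s v -> v \in span s.
Proof.
apply: (@Zspan_min _ _ (fun v => v \in span s)) => [|u w|u|x].
- exact: mem0v.
- exact: memvD.
- by rewrite memvN.
- exact: memv_span.
Qed.

(** Over the common denominator [D] this is Bezout for the numerators [X] and [Y]; [g] generates the
    subgroup spanned by [x] and [y]. *)
Lemma rat_gcd (x y : rat) : exists g : rat,
  [/\ exists a : int, x = g *~ a, exists a : int, y = g *~ a &
      exists a c : int, g = x *~ a + y *~ c].
Proof.
pose X := numq x * denq y; pose Y := numq y * denq x.
pose D : rat := (denq x)%:~R * (denq y)%:~R.
have dx : (denq x)%:~R != 0 :> rat by rewrite intr_eq0 denq_eq0.
have dy : (denq y)%:~R != 0 :> rat by rewrite intr_eq0 denq_eq0.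
have xE : x = X%:~R / D.
  by rewrite /X /D intrM invfM mulrACA divff // mulr1 divq_num_den.
have yE : y = Y%:~R / D.
  by rewrite /Y /D intrM [(denq x)%:~R * _]mulrC invfM mulrACA divff // mulr1 divq_num_den.
exists ((gcdz X Y)%:~R / D); split.
- exists (X %/ gcdz X Y)%Z.
  by rewrite -mulrzr mulrAC -intrM mulrC [gcdz _ _ * _]mulrC divzK ?dvdz_gcdl // mulrC.
- exists (Y %/ gcdz X Y)%Z.
  by rewrite -mulrzr mulrAC -intrM mulrC [gcdz _ _ * _]mulrC divzK ?dvdz_gcdr // mulrC.
have [u [v <-]] := Bezoutz X Y; exists u, v.
have -> : x *~ u = X%:~R / D *~ u by rewrite -xE.
have -> : y *~ v = Y%:~R / D *~ v by rewrite -yE.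
rewrite intrD mulrDl; congr (_ + _).
  by rewrite intrM -[RHS]mulrzl mulrA.
by rewrite intrM -[RHS]mulrzl mulrA.
Qed.

Lemma Zspan_rat_cyclic (s : seq rat) : exists q : rat,
  forall x, Zspan s x <-> exists c : int, x = q *~ c.
Proof.
elim: s => [|y s [q qP]] /=.
  by exists 0 => x; split=> [->|[c ->]]; [exists 0|]; rewrite mul0rz.
have [g [[a ya] [d qd] [u [v gE]]]] := rat_gcd y q.
exists g => x; split=> [[c /qP[c' e]]|[c ->]].
  exists (a * c + d * c').
  by rewrite -(subrK (y *~ c) x) e {1}qd ya -!mulrzA addrC -mulrzDr.
exists (u * c); apply/qP; exists (v * c).
by rewrite gE mulrzDl -!mulrzA addrAC subrr add0r.
Qed.

(* Splitting off one generator along a linear functional [phi]: the values of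
   [phi] on the group form a cyclic group, so a generator of it lifts. *)
Lemma Zspan_free (V : vectType rat) (s : seq V) : exists e : seq V,
  free e /\ Zspan s = Zspan e.
Proof.
move: {2}(\dim (span s)) (leqnn (\dim (span s))) => n; elim: n s => [|n IH] s dims.
  exists [::]; split; first exact: nil_free.
  move: dims; rewrite leqn0 dimv_eq0 => /eqP s0.
  apply/seteqP; split=> v /=; last by move->; apply: Zspan0.
  by move/Zspan_span; rewrite s0 memv0 => /eqP.
have [s0|] := altP (@allP _ (pred1 0) s).
  exists [::]; split; first exact: nil_free.
  apply/seteqP; split=> v /=; last by move->; apply: Zspan0.
  apply: (@Zspan_min _ _ (fun v => v = 0)) => [//|u w -> ->|u ->|x /s0/eqP//].
    by rewrite addr0.
  by rewrite oppr0.
rewrite -has_predC => /hasP[x xs /= x0].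
have [i xi] : exists i, coord (vbasis {:V}) i x != 0.
  apply/existsP; apply: contraNT x0; rewrite negb_exists => /forallP xi.
  rewrite (coord_vbasis (memvf x)); apply/eqP/big1 => i _.
  by move: (xi i); rewrite negbK => /eqP->; rewrite scale0r.
pose phi : {linear V -> rat^o} := coord (vbasis {:V}) i.
have [q qP] := Zspan_rat_cyclic (map phi s).
have q0 : q != 0.
  apply: contraNneq xi => q0.
  have /qP[c e] : Zspan (map phi s) (phi x) by apply/Zspan_mem/map_f.
  by rewrite -[coord _ i x]/(phi x) e q0 mul0rz.
have /qP : exists c : int, q = q *~ c by exists 1.
rewrite (@Zspan_map _ _ phi) => -[a sa aq].
have phiZ v : Zspan s v -> exists c : int, phi v / q = c%:~R.
  move=> sv; have /qP[c ->] : Zspan (map phi s) (phi v).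
    by rewrite (@Zspan_map _ _ phi); exists v.
  by exists c; rewrite -mulrzl mulfK.
(* [f] projects along [a] onto the kernel of [phi]. It preserves the group because [phi v / q] is an
   integer there, and its image spans a smaller space, so the induction hypothesis applies to
   [map f s]. *)
pose f : 'End(V) := linfun (fun v => v - (phi v / q) *: a).
have flin : linear (fun v => v - (phi v / q) *: a).
  by move=> k u v; rewrite linearP /= mulrDl scalerDl scalerBr opprD -!scalerA addrACA.
have fE v : f v = v - (phi v / q) *: a.
  pose g := GRing.isLinear.Build rat V V *:%R _ flin.
  pose h : {linear V -> V} := HB.pack (fun v => v - (phi v / q) *: a) g.
  by rewrite /f -[fun v => _]/(h : V -> V) lfunE.
have phif v : phi (f v) = 0.
  rewrite fE linearB linearZ /= aq.
  have -> : (phi v / q) *: (q : rat^o) = phi v by exact: divfK.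
  by rewrite subrr.
have fs v : Zspan s v -> Zspan s (f v).
  move=> sv; rewrite fE; apply: ZspanD => //; apply: ZspanN.
  by have [c ->] := phiZ v sv; rewrite scaler_int; apply: ZspanM.
have [|e [e_free eE]] := IH (map f s).
  rewrite -ltnS; apply: leq_trans dims; rewrite ltnNge; apply/negP => ds.
  have sub : (span (map f s) <= span s)%VS.
    by apply/span_subvP => _ /mapP[y ys ->]; apply/Zspan_span/fs/Zspan_mem.
  have E : (span (map f s) == span s)%VS by rewrite eqEdim sub ds.
  have /subvP kers : (span (map f s) <= lker (linfun phi))%VS.
    by apply/span_subvP => _ /mapP[y ys ->]; rewrite memv_ker lfunE /= phif.
  have : x \in span (map f s) by rewrite (eqP E) memv_span.
  by move/kers; rewrite memv_ker lfunE /= => xi0; case/negP: xi.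
have eker : (span e <= lker (linfun phi))%VS.
  apply/span_subvP => y /(@Zspan_mem V); rewrite -eE (@Zspan_map _ _ f) => -[z _ <-].
  by rewrite memv_ker lfunE /= phif.
exists (a :: e); split.
  rewrite free_cons e_free andbT; apply: contraNN q0 => /(subvP eker).
  by rewrite memv_ker lfunE /= aq.
apply/seteqP; split=> v /=; rewrite -eE (@Zspan_map _ _ f).
  move=> sv; have [c cE] := phiZ v sv; exists c, v => //.
  by rewrite -scaler_int -cE; apply: fE.
move=> [c [w sw e']]; rewrite -(subrK (a *~ c) v) -e'.
by apply: ZspanD; [exact: fs|exact: ZspanM].
Qed.

Lemma fg_subgroupP (V : vectType rat) (A : set V) :
  fg_subgroup A <-> exists s, A = Zspan s.
Proof.
split=> [[m [s ->]]|[s ->]].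
  by exists s; apply/seteqP; split=> v; rewrite /= ZspanP.
by exists (size s), (in_tuple s); apply/seteqP; split=> v; rewrite /= -ZspanP.
Qed.

Lemma fg_subgroup_basis (V : vectType rat) (A : set V) :
  fg_subgroup A -> exists e : seq V, free e /\ A = Zspan e.
Proof. by move/fg_subgroupP=> [s ->]; apply: Zspan_free. Qed.

Lemma fg_subgroup_image (V W : vectType rat) (f : {linear V -> W}) (A : set V) :
  fg_subgroup A -> fg_subgroup (f @` A).
Proof.
by move/fg_subgroupP=> [s ->]; apply/fg_subgroupP; exists (map f s); rewrite Zspan_map.
Qed.

End IntegralSpan.

(** * Linear maps, forms and dual lattices *)

Section LinearMaps.

Lemma dim_dualv (vT : vectType rat) : \dim {: dualv vT} = \dim {:vT}.
Proof. by rewrite !dimvf /dim /= muln1. Qed.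

Lemma lker0_limgf (aT rT : vectType rat) (f : 'Hom(aT, rT)) :
  \dim {:aT} = \dim {:rT} -> lker f = 0%VS -> limg f = fullv.
Proof.
move=> dimE f0; apply/eqP; rewrite eqEdim subvf /= -dimE limg_dim_eq //.
by rewrite f0 capv0.
Qed.

Lemma limgf_invK (aT rT : vectType rat) (f : 'Hom(aT, rT)) :
  limg f = fullv -> cancel (f^-1)%VF f.
Proof. by move=> f1 x; apply: limg_lfunVK; rewrite f1 memvf. Qed.

Lemma lker0_invK (aT rT : vectType rat) (f : 'Hom(aT, rT)) :
  lker f = 0%VS -> cancel f (f^-1)%VF.
Proof. by move=> /eqP f0; apply: lker0_lfunK. Qed.

Lemma lker0_intro (aT rT : vectType rat) (f : 'Hom(aT, rT)) :
  (forall x, f x = 0 -> x = 0) -> lker f = 0%VS.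
Proof.
move=> f0; apply/eqP; rewrite -subv0; apply/subvP => x; rewrite memv_ker => /eqP.
by move/f0=> ->; apply: mem0v.
Qed.

Lemma linear_lfun (aT rT : vectType rat) (f : aT -> rT) :
  linear f -> exists F : 'Hom(aT, rT), F =1 f.
Proof.
move=> flin; pose g := GRing.isLinear.Build rat aT rT *:%R _ flin.
pose h : {linear aT -> rT} := HB.pack f g.
by exists (linfun h) => x; rewrite lfunE.
Qed.

(** All maps are variables here, so that expanding the compositions of (iv) stops at the transported
    maps instead of opening them. *)
Lemma eta_map_aux (aT rT sT : vectType rat) (M : 'End(rT)) (f : 'Hom(aT, rT))
    (S : 'End(aT)) (P : 'Hom(aT, sT)) (Q : 'Hom(sT, rT)) (c : rat) x :
  ((\1 - M) \o f \o (\1 - S) + (M \o f) - (f \o S) - c *: (Q \o P))%VF x =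
  f (x - S x) - M (f (x - S x)) + M (f x) - f (S x) - c *: Q (P x).
Proof. by rewrite !(add_lfunE, opp_lfunE, scale_lfunE, id_lfunE, comp_lfunE). Qed.

Variable V : vectType rat.

Lemma vsvalD (X : {vspace V}) (x y : subvs_of X) :
  vsval (x + y) = vsval x + vsval y.
Proof. by []. Qed.
Lemma vsvalN (X : {vspace V}) (x : subvs_of X) : vsval (- x) = - vsval x.
Proof. exact: raddfN. Qed.
Lemma vsvalB (X : {vspace V}) (x y : subvs_of X) :
  vsval (x - y) = vsval x - vsval y.
Proof. exact: raddfB. Qed.
Lemma vsvalZ (X : {vspace V}) a (x : subvs_of X) : vsval (a *: x) = a *: vsval x.
Proof. by []. Qed.
Lemma vsval0 (X : {vspace V}) : vsval (0 : subvs_of X) = 0.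
Proof. exact: raddf0. Qed.
Lemma vsvalMn (X : {vspace V}) (x : subvs_of X) n : vsval (x *+ n) = vsval x *+ n.
Proof. exact: raddfMn. Qed.

Lemma linfun_vsvalE (X : {vspace V}) (x : subvs_of X) : linfun (@vsval _ _ X) x = vsval x.
Proof. by rewrite lfunE. Qed.
Lemma linfun_vsprojE (X : {vspace V}) v : linfun (vsproj X) v = vsproj X v.
Proof. by rewrite lfunE. Qed.

End LinearMaps.

Section SymmetricForm.
Variables (V : vectType rat) (b : {symmetric V}).

Lemma formC u v : b u v = b v u.
Proof. by rewrite hermC expr0 mul1r. Qed.
Lemma formDr u v w : b u (v + w) = b u v + b u w. Proof. exact: linearDr. Qed.
Lemma formDl u v w : b (u + v) w = b u w + b v w. Proof. exact: linearDl. Qed.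
Lemma formNr u v : b u (- v) = - b u v. Proof. exact: linearNr. Qed.
Lemma formNl u v : b (- u) v = - b u v. Proof. exact: linearNl. Qed.
Lemma form0r u : b u 0 = 0. Proof. exact: linear0r. Qed.
Lemma form0l u : b 0 u = 0. Proof. exact: linear0l. Qed.
Lemma formZr a u v : b u (a *: v) = a * b u v. Proof. exact: linearZr. Qed.
Lemma formZl a u v : b (a *: u) v = a * b u v. Proof. exact: linearZl. Qed.
Lemma formMl u v n : b (u *+ n) v = b u v *+ n.
Proof. by rewrite -scaler_nat formZl mulr_natl. Qed.
Lemma form_sumr (I : Type) (r : seq I) (P : pred I) (F : I -> V) u :
  b u (\sum_(i <- r | P i) F i) = \sum_(i <- r | P i) b u (F i).
Proof. by elim/big_rec2: _ => [|i x y _ <-]; rewrite ?form0r ?formDr. Qed.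
Lemma form_suml (I : Type) (r : seq I) (P : pred I) (F : I -> V) u :
  b (\sum_(i <- r | P i) F i) u = \sum_(i <- r | P i) b (F i) u.
Proof. by rewrite formC form_sumr; apply: eq_bigr => i _; rewrite formC. Qed.
Definition formE := (formDl, formDr, formNl, formNr, form0l, form0r, formZl, formZr).

Lemma nondegenerate_eq0 u : nondegenerate b -> (forall v, b u v = 0) -> u = 0.
Proof.
move=> /eqP ndeg u0; apply/eqP; rewrite -memv0 -ndeg; apply/mem_orthovP => v _.
exact: u0.
Qed.

Lemma nondegenerate_ker : (forall u, (forall v, b u v = 0) -> u = 0) ->
  lker (to_dual b) = 0%VS.
Proof.
move=> ndeg; apply/eqP; rewrite -subv0; apply/subvP => u; rewrite memv_ker => /eqP u0.
rewrite memv0; apply/eqP/ndeg => v.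
by rewrite -to_dualE u0 lfunE.
Qed.

Lemma riesz (f : dualv V) : nondegenerate b -> exists v, forall x, b v x = f x.
Proof.
move=> ndeg; exists ((to_dual b)^-1%VF f) => x.
rewrite -to_dualE limgf_invK // lker0_limgf ?dim_dualv //.
by apply: nondegenerate_ker => u; apply: nondegenerate_eq0.
Qed.

Lemma isometry_bij (A : 'End(V)) : nondegenerate b -> O_Q b A ->
  cancel A (A^-1)%VF /\ cancel (A^-1)%VF A.
Proof.
move=> ndeg isoA.
have A0 : lker A = 0%VS.
  apply/eqP; rewrite -subv0; apply/subvP => u; rewrite memv_ker => /eqP u0.
  rewrite memv0; apply/eqP/nondegenerate_eq0 => // v.
  by rewrite -isoA u0 form0l.
by split; [apply: lker0_invK|apply: limgf_invK; apply: lker0_limgf].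
Qed.

End SymmetricForm.

Section LatticeDuality.
Variables (V : vectType rat) (b : {symmetric V}).
Implicit Types (L A : set V).

Lemma Zspan_coord (e : seq V) v :
    v \in span e -> (forall i, coord (in_tuple e) i v \is a Num.int) ->
  Zspan e v.
Proof.
move=> ve vi; apply/(@ZspanP _ _ (in_tuple e)).
exists [ffun i => Num.floor (coord (in_tuple e) i v)].
rewrite [LHS](@coord_span _ _ _ (in_tuple e)) //; apply: eq_bigr => i _.
by rewrite ffunE -scaler_int floorK.
Qed.

Lemma Zspan_pos_multiple (e : seq V) v :
  v \in span e -> exists2 n : nat, (0 < n)%N & Zspan e (v *+ n).
Proof.
move=> /(@coord_span _ _ _ (in_tuple e)) ->.
elim/big_rec: _ => [|i x _ [n n0 xn]]; first by exists 1%N => //; apply: Zspan0.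
set c : rat := coord _ i v; exists (n * `|denq c|)%N.
  by rewrite muln_gt0 n0 lt0n absz_eq0 denq_eq0.
rewrite mulrnDl; apply: ZspanD; last by rewrite mulrnA [_ *+ `|_|]pmulrn; apply: ZspanM.
rewrite mulnC mulrnA [_ *+ n]pmulrn; apply: ZspanM.
rewrite -scaler_nat scalerA.
have -> : `|denq c|%:R * c = (numq c)%:~R.
  by rewrite -[c in _ * c]divq_num_den mulrCA pmulrn absz_denq mulfV ?mulr1 // intr_eq0 denq_eq0.
by rewrite scaler_int; apply/ZspanM/Zspan_mem/mem_nth.
Qed.

Lemma Qspan_Zspan (e : seq V) : Qspan (Zspan e) = span e.
Proof.
have [sub min] := QspanP (Zspan e); apply/eqP; rewrite eqEsubv min /=.
  by apply/span_subvP => x xe; apply/sub/Zspan_mem.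
by move=> v /Zspan_span.
Qed.

(** Polarization: twice the pairing is a combination of three even norms. *)
Lemma even_lattice_int L u v : even_lattice b L -> L u -> L v ->
  b u v \is a Num.int.
Proof.
move=> [/fg_subgroupP[s ->] _ ev] Lu Lv.
have [k kE] := ev _ (ZspanD Lu Lv); have [l lE] := ev _ Lu; have [m mE] := ev _ Lv.
have e : b u v *+ 2 = (k - l - m)%:~R *+ 2.
  rewrite -[RHS]rmorphMn /= !mulrnBl !intrB -kE -lE -mE !formE [b v u]formC.
  by rewrite mulr2n; ring.
suff -> : b u v = (k - l - m)%:~R by apply: rpred_int.
by move/eqP: e; rewrite eqr_pMn2r // => /eqP.
Qed.

Lemma even_lattice_basis L : even_lattice b L ->
  exists e : seq V, [/\ free e, L = Zspan e & span e = fullv].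
Proof.
by move=> [/fg_subgroup_basis[e [e_free ->]] + _]; exists e; rewrite -Qspan_Zspan.
Qed.

Lemma even_lattice_sub_dual L : even_lattice b L -> L `<=` dual_lattice b L.
Proof. by move=> Lev v Lv w Lw; apply: even_lattice_int Lev Lv Lw. Qed.

(** By Riesz, each coordinate functional of a basis of [L] is the pairing with some [w] in the dual
    lattice; the hypothesis then makes every coordinate of [v] integral. *)
Lemma double_dual L v : nondegenerate b -> even_lattice b L ->
  (forall w, dual_lattice b L w -> b v w \is a Num.int) -> L v.
Proof.
move=> ndeg /even_lattice_basis[e [e_free -> efull]] vdual.
apply: Zspan_coord => [|i]; first by rewrite efull memvf.
have [w wE] := riesz (linfun (coord (in_tuple e) i : V -> rat^o)) ndeg.
rewrite -[coord _ _ _](lfunE (coord (in_tuple e) i : {linear V -> rat^o})) -wE formC.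
apply: vdual => x /(@ZspanP _ _ (in_tuple e))[a ->].
rewrite wE lfunE /= linear_sum rpred_sum // => j _.
by rewrite -scaler_int linearZ /= coord_free // rpredM ?rpred_int ?rpred_nat.
Qed.

Lemma even_lattice_sub L u v : even_lattice b L -> L u -> L v -> L (u - v).
Proof.
by move=> [/fg_subgroupP[s ->] _ _] Lu Lv; apply: ZspanD => //; apply: ZspanN.
Qed.

(** First [A] maps [L] into itself. For [v] in [L] the vector [w = A^-1 v] then lies in the dual
    lattice, since its pairing with [l] is that of [v] with [A l]; hence [v - w = A w - w] is in
    [L], and so is [w]. Stated from closure under subtraction and integrality only, so that it also
    applies to [redlattice b U L]. *)
Lemma isometry_latticeP L (A : 'End(V)) : nondegenerate b ->
    (forall u v, L u -> L v -> L (u - v)) -> L `<=` dual_lattice b L ->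
    O_Q b A ->
  (A @` L = L /\ forall v, dual_lattice b L v -> L (A v - v)) <->
  (forall v, dual_lattice b L v -> L (A v - v)).
Proof.
move=> ndeg lattice_sub Ldual isoA; split=> [[]//|AL]; split=> //.
have [AK AVK] := isometry_bij ndeg isoA.
have lattice_add u v : L u -> L v -> L (u + v).
  move=> Lu Lv; have lattice0 : L 0 by rewrite -(subrr u); apply: lattice_sub.
  by rewrite -(opprK v) -[- v]add0r; apply: (lattice_sub) => //; apply: lattice_sub.
have AL1 v : L v -> L (A v).
  by move=> Lv; rewrite -(subrK v (A v)); apply: lattice_add => //; apply/AL/Ldual.
apply/seteqP; split=> [_ [v Lv <-]|v Lv]; first exact: AL1.
exists ((A^-1)%VF v) => //.
have Lw : dual_lattice b L ((A^-1)%VF v).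
  by move=> l Ll; rewrite -isoA AVK; apply/Ldual/AL1.
have := AL _ Lw; rewrite AVK => Lvw.
by rewrite -(subKr v ((A^-1)%VF v)); apply: lattice_sub.
Qed.

End LatticeDuality.

(** * Continuity and determinants of real matrices *)

Section RealContinuity.
Variable R : realType.

Lemma continuous_mulr (T : topologicalType) (f g : T -> R) :
  continuous f -> continuous g -> continuous (fun x => f x * g x).
Proof. by move=> fc gc x; apply: continuousM; [apply: fc|apply: gc]. Qed.

Lemma continuous_bigD (T : topologicalType) (I : Type) (r : seq I) (P : pred I)
    (f : I -> T -> R) : (forall i, continuous (f i)) ->
  continuous (fun x => \sum_(i <- r | P i) f i x).
Proof.
move=> fc x; rewrite /continuous_at; elim: r => [|i r IH].
  under eq_fun do rewrite big_nil; rewrite big_nil; exact: cvg_cst.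
under eq_fun do rewrite big_cons; rewrite big_cons; case: (P i) => //.
by apply: cvgD => //; apply: fc.
Qed.

Lemma continuous_bigM (T : topologicalType) (I : Type) (r : seq I) (P : pred I)
    (f : I -> T -> R) : (forall i, continuous (f i)) ->
  continuous (fun x => \prod_(i <- r | P i) f i x).
Proof.
move=> fc x; rewrite /continuous_at; elim: r => [|i r IH].
  under eq_fun do rewrite big_nil; rewrite big_nil; exact: cvg_cst.
under eq_fun do rewrite big_cons; rewrite big_cons; case: (P i) => //.
by apply: cvgM => //; apply: fc.
Qed.

Lemma continuous_matrix (T : topologicalType) m n (F : T -> 'M[R]_(m, n)) :
  (forall i j, continuous (fun x => F x i j)) -> continuous F.
Proof.
move=> Fc x A [P PF PA].
suff : \forall y \near x, forall i j, P i j (F y i j).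
  by apply: filterS => y Py; apply: PA => i j.
apply: filter_forall => i; apply: filter_forall => j.
exact: (Fc i j x _ (PF i j)).
Qed.

Lemma continuous_mulmx_const m n p q (X : 'M[R]_(p, m)) (Y : 'M[R]_(n, q)) :
  continuous (fun g : 'M[R]_(m, n) => X *m g *m Y).
Proof.
apply: continuous_matrix => i j.
rewrite (_ : (fun g : 'M[R]_(m, n) => _) =
    fun g => \sum_k \sum_l X i l * g l k * Y k j); last first.
  by apply/funext => g; rewrite mxE; apply: eq_bigr => k _; rewrite mxE mulr_suml.
apply: continuous_bigD => k; apply: continuous_bigD => l.
apply: continuous_mulr; last by move=> g; apply: cst_continuous.
apply: continuous_mulr; first by move=> g; apply: cst_continuous.
exact: coord_continuous.
Qed.

Lemma continuous_addmx_const (T : topologicalType) m n (F : T -> 'M[R]_(m, n)) X :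
  continuous F -> continuous (fun x => X + F x).
Proof.
move=> Fc; apply: continuous_matrix => i j x.
rewrite /continuous_at; under eq_fun do rewrite mxE; rewrite mxE.
apply: cvgD; first exact: cvg_cst.
by apply: (@continuous_comp _ _ _ F (fun M => M i j)); [exact: Fc|apply: coord_continuous].
Qed.

Lemma continuous_det n : continuous (fun g : 'M[R]_n => \det g).
Proof.
apply: continuous_bigD => s; apply: continuous_mulr.
  by move=> g; apply: cst_continuous.
by apply: continuous_bigM => i g; apply: coord_continuous.
Qed.

Lemma connected_component_image (T T' : topologicalType) (f : T -> T')
    (A : set T) (B : set T') x y : continuous f ->
    (forall z, A z -> B (f z)) ->
  connected_component A x y -> connected_component B (f x) (f y).
Proof.
move=> fc fAB [C [Cx CA Cconn] Cy].
exists (f @` C); last by exists y.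
split; first by exists x.
  by move=> _ [z Cz <-]; apply/fAB/CA.
apply: connected_continuous_connected => //.
exact: continuous_subspaceT.
Qed.

(** A connected subset of the line is an interval, so an image avoiding 0 cannot contain values of
    both signs. *)
Lemma connected_component_gt0 (T : topologicalType) (f : T -> R) (A : set T) x y :
    continuous f -> (forall z, A z -> f z != 0) -> 0 < f x ->
  connected_component A x y -> 0 < f y.
Proof.
move=> fc fA fx Axy.
have := connected_component_image (B := [set z : R | z != 0]) fc fA Axy.
move=> [C [Cx C0 /connected_intervalP Cint] Cy].
rewrite ltNge; apply/negP => fy.
have /C0 /= : C 0 by apply: (Cint _ _ Cy Cx); rewrite fy ltW.
by rewrite eqxx.
Qed.

End RealContinuity.

Section RealMatrices.
Variable R : realType.

(** [real_mx] for maps between different spaces. Vectors are rows, so composition becomes the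
    product in the opposite order. *)
Definition rmx (aT rT : vectType rat) (f : 'Hom(aT, rT)) :
    'M[R]_(\dim {:aT}, \dim {:rT}) :=
  map_mx ratr (passmx.mxof (vbasis {:aT}) (vbasis {:rT}) f).

Lemma mxof_coord (aT rT : vectType rat) (e : (\dim {:aT}).-tuple aT)
    (e' : (\dim {:rT}).-tuple rT) (f : 'Hom(aT, rT)) i j :
  passmx.mxof e e' f i j = coord e' j (f e`_i).
Proof. by rewrite !mxE /= passmx.vecof_delta. Qed.

Lemma rmxE (aT rT : vectType rat) (f : 'Hom(aT, rT)) i j :
  rmx f i j = ratr (coord (vbasis {:rT}) j (f (vbasis {:aT})`_i)).
Proof. by rewrite /rmx mxE mxof_coord. Qed.

Lemma rmx_comp (aT rT sT : vectType rat) (f : 'Hom(aT, rT)) (g : 'Hom(rT, sT)) :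
  rmx (g \o f)%VF = rmx f *m rmx g.
Proof. by rewrite /rmx (passmx.mxof_comp _ _ (vbasisP _)) map_mxM. Qed.

Lemma rmx1 (aT : vectType rat) : rmx (\1%VF : 'End(aT)) = 1%:M.
Proof. by rewrite /rmx passmx.mxof1 ?map_mx1 // (basis_free (vbasisP _)). Qed.

Lemma rmxD (aT rT : vectType rat) (f g : 'Hom(aT, rT)) :
  rmx (f + g) = rmx f + rmx g.
Proof. by apply/matrixP => i j; rewrite [RHS]mxE !rmxE add_lfunE linearD rmorphD. Qed.

Lemma rmx0 (aT rT : vectType rat) : rmx (0 : 'Hom(aT, rT)) = 0.
Proof. by apply/matrixP => i j; rewrite [RHS]mxE rmxE zero_lfunE linear0 rmorph0. Qed.

(** The entries of such a product are values of the rational form on basis vectors; this is how real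
    matrix identities are reduced to rational ones. *)
Lemma rmx_gramE (V aT aT' : vectType rat) (b : {symmetric V})
    (f : 'Hom(aT, V)) (g : 'Hom(aT', V)) i j :
  (rmx f *m real_gram R b *m (rmx g)^T) i j =
  ratr (b (f (vbasis {:aT})`_i) (g (vbasis {:aT'})`_j)).
Proof.
rewrite [f _](coord_vbasis (memvf _)) [g _](coord_vbasis (memvf _)).
rewrite form_sumr rmorph_sum mxE /=; apply: eq_bigr => l _.
rewrite mxE form_suml rmorph_sum mulr_suml; apply: eq_bigr => k _.
rewrite rmxE [_^T _ _]mxE rmxE [real_gram _ _ _ _]mxE formZl formZr !rmorphM /=.
by rewrite -mulrA [ratr (b _ _) * _]mulrC mulrCA mulrA.
Qed.

Lemma rmx_gram_eq (V V' aT aT' : vectType rat) (b : {symmetric V}) (c : {symmetric V'})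
    (f : 'Hom(aT, V)) (g : 'Hom(aT', V)) (f' : 'Hom(aT, V')) (g' : 'Hom(aT', V')) :
  (forall x y, b (f x) (g y) = c (f' x) (g' y)) ->
  rmx f *m real_gram R b *m (rmx g)^T = rmx f' *m real_gram R c *m (rmx g')^T.
Proof. by move=> e; apply/matrixP => i j; rewrite !rmx_gramE e. Qed.

Lemma rmx_gram0 (V aT aT' : vectType rat) (b : {symmetric V})
    (f : 'Hom(aT, V)) (g : 'Hom(aT', V)) :
  (forall x y, b (f x) (g y) = 0) -> rmx f *m real_gram R b *m (rmx g)^T = 0.
Proof. by move=> e; apply/matrixP => i j; rewrite rmx_gramE e rmorph0 mxE. Qed.

Lemma det_rmx (aT : vectType rat) (f : 'End(aT)) : \det (rmx f) = ratr (lfun_det f).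
Proof. by rewrite det_map_mx. Qed.

Lemma O_R_mul (V : vectType rat) (b : {symmetric V}) (g g' : 'M[R]_(\dim {:V})) :
  O_R b g -> O_R b g' -> O_R b (g *m g').
Proof.
move=> gG g'G; rewrite /O_R /mkset trmx_mul mulmxA -(mulmxA g g').
by rewrite -(mulmxA g (g' *m _)) g'G gG.
Qed.

Lemma O_R_rmx (V : vectType rat) (b : {symmetric V}) (A : 'End(V)) :
  O_Q b A -> O_R b (rmx A).
Proof.
move=> AO; rewrite /O_R /mkset.
have {2}-> : real_gram R b = rmx \1%VF *m real_gram R b *m (rmx \1%VF)^T.
  by rewrite rmx1 trmx1 mul1mx mulmx1.
by apply: rmx_gram_eq => x y; rewrite !id_lfunE AO.
Qed.

End RealMatrices.

Section LatticeDeterminant.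
Variable V : vectType rat.

Lemma lfun_det_basis (e : (\dim {:V}).-tuple V) (M : 'End(V)) :
  basis_of {:V} e -> lfun_det M = \det (passmx.mxof e e M).
Proof.
move=> eb; pose v := vbasis {:V}; have vb : basis_of {:V} v := vbasisP _.
have -> : lfun_det M =
    \det (passmx.mxof v e \1%VF *m passmx.mxof e e M *m passmx.mxof e v \1%VF).
  by rewrite -!passmx.mxof_comp // comp_lfun1r comp_lfun1l.
rewrite !det_mulmx mulrAC -det_mulmx -passmx.mxof_comp // comp_lfun1l.
by rewrite passmx.mxof1 ?det1 ?mul1r // (basis_free vb).
Qed.

Lemma det_int n (X : 'M[rat]_n) :
  (forall i j, X i j \is a Num.int) -> \det X \is a Num.int.
Proof.
move=> XI; apply: rpred_sum => s _; apply: rpredM; first by rewrite rpredX ?rpredN1.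
by apply: rpred_prod.
Qed.

(** In the basis [s] both [M] and its inverse have integral matrices, so the determinant is a unit
    of the integers. *)
Lemma lfun_det_lattice (s : seq V) (M : 'End(V)) :
    free s -> span s = fullv -> M @` Zspan s = Zspan s ->
  lfun_det M = 1 \/ lfun_det M = -1.
Proof.
move=> s_free s_full Ms.
have sz : size s == \dim {:V} by move: s_free; rewrite /free s_full eq_sym.
pose e := Tuple sz; have eb : basis_of {:V} e by rewrite /basis_of /= s_full eqxx.
have coordI v j : Zspan s v -> coord e j v \is a Num.int.
  apply: (@Zspan_min _ _ (fun v => coord e j v \is a Num.int)).
  - by rewrite linear0.
  - by move=> x y; rewrite linearD; apply: rpredD.
  - by move=> x; rewrite linearN rpredN.
  move=> x /(nthP 0)[i ilt <-]; rewrite (eqP sz) in ilt.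
  by rewrite (coord_free (Ordinal ilt)) //; apply: rpred_nat.
have mxI (N : 'End(V)) : (forall v, Zspan s v -> Zspan s (N v)) ->
    lfun_det N \is a Num.int.
  move=> NI; rewrite (lfun_det_basis _ eb); apply: det_int => i j.
  rewrite mxof_coord; apply/coordI/NI/Zspan_mem/mem_nth.
  by rewrite (eqP sz).
have Mfull : limg M = fullv.
  apply/eqP; rewrite eqEsubv subvf /= -s_full; apply/span_subvP => x /Zspan_mem.
  by rewrite -Ms => -[y _ <-]; rewrite memv_img ?s_full ?memvf.
have M0 : lker M = 0%VS.
  apply/eqP; rewrite -dimv_eq0; have := limg_ker_dim M fullv.
  by rewrite Mfull capfv => /eqP; rewrite -{2}[\dim fullv]add0n eqn_add2r.
have /mxI/intrP[x xE] : forall v, Zspan s v -> Zspan s (M v).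
  by move=> v sv; rewrite -Ms; exists v.
have /mxI/intrP[y yE] : forall v, Zspan s v -> Zspan s (M^-1%VF v).
  by move=> v; rewrite -{1}Ms => -[z sz' <-]; rewrite lker0_invK.
have : lfun_det M * lfun_det M^-1%VF = 1.
  rewrite /lfun_det -det_mulmx -passmx.mxof_comp ?vbasisP //.
  rewrite (_ : (M^-1 \o M)%VF = \1%VF) ?passmx.mxof1 ?det1 // ?(basis_free (vbasisP _)) //.
  by apply/lfunP => z; rewrite comp_lfunE lker0_invK // id_lfunE.
rewrite {1}xE yE -intrM -[RHS](mulr1z 1) => /intr_inj xy.
have : (`|x| * `|y| == 1)%N by rewrite -abszM xy.
rewrite muln_eq1 => /andP[/eqP x1 _]; case: x xE x1 {xy} => n -> /=.
  by move=> ->; left.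
by move=> [->]; right.
Qed.

End LatticeDeterminant.

(** * The decomposition of V along U *)

Section Decomposition.
Variables (V : vectType rat) (b : {symmetric V}) (L : set V) (U : {vspace V}).
Variables (It : set V) (Ut : {vspace V}).
Hypothesis ndeg : nondegenerate b.
Hypothesis Lev : even_lattice b L.
Hypothesis Uiso : (U <= orthov b U)%VS.
Hypothesis It_fg : fg_subgroup It.
Hypothesis It_dual : It `<=` dual_lattice b L.
Hypothesis It_unimod : unimodular_pairing b U L It.
Hypothesis UtE : Ut = Qspan It.

Local Notation W := (redspace b U).
Local Notation Wt := (Wt b U Ut).
Local Notation Ld := (dual_lattice b L).
Implicit Types (u : subvs_of U) (t : subvs_of Ut) (w : subvs_of Wt) (v : V).

Lemma lattice_sub v v' : L v -> L v' -> L (v - v').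
Proof. exact: (even_lattice_sub Lev). Qed.
Lemma lattice0 : L 0. Proof. by have [/fg_subgroupP[s ->] _ _] := Lev; apply: Zspan0. Qed.
Lemma lattice_opp v : L v -> L (- v).
Proof. by rewrite -[- v]add0r; apply: lattice_sub; apply: lattice0. Qed.
Lemma lattice_add v v' : L v -> L v' -> L (v + v').
Proof. by move=> Lv Lv'; rewrite -(opprK v'); apply: lattice_sub => //; apply: lattice_opp. Qed.

Lemma dual_opp v : Ld v -> Ld (- v).
Proof. by move=> Lv l /Lv; rewrite formNl rpredN. Qed.
Lemma dual_add v v' : Ld v -> Ld v' -> Ld (v + v').
Proof. by move=> Lv Lv' l Ll; rewrite formDl rpredD ?Lv ?Lv'. Qed.
Lemma lattice_dual v : L v -> Ld v.
Proof. exact: (even_lattice_sub_dual Lev). Qed.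

Lemma form_UU u u' : b (vsval u) (vsval u') = 0.
Proof. by move/orthovP: Uiso; apply; apply: subvsP. Qed.

Lemma idUE t u : idU b U Ut t u = b (vsval t) (vsval u).
Proof. by rewrite comp_lfunE pairUE lfunE. Qed.

Lemma idU'E u t : idU b Ut U u t = b (vsval u) (vsval t).
Proof. by rewrite comp_lfunE pairUE lfunE. Qed.

Lemma form_WU w u : b (vsval w) (vsval u) = 0.
Proof. by have /mem_orthovP := subvsP w; apply; apply/(subvP (addvSl _ _))/subvsP. Qed.
Lemma form_UW u w : b (vsval u) (vsval w) = 0.
Proof. by rewrite formC form_WU. Qed.
Lemma form_WT w t : b (vsval w) (vsval t) = 0.
Proof. by have /mem_orthovP := subvsP w; apply; apply/(subvP (addvSr _ _))/subvsP. Qed.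
Lemma form_TW t w : b (vsval t) (vsval w) = 0.
Proof. by rewrite formC form_WT. Qed.

Lemma It_Ut v : It v -> v \in Ut.
Proof. by have [sub _] := QspanP It; rewrite UtE; apply: sub. Qed.

(** Every vector of [Ut] has a positive multiple in [It], where unimodularity gives injectivity. *)
Lemma idU_ker : lker (idU b U Ut) = 0%VS.
Proof.
apply: lker0_intro => t t0.
have [e [_ ItE]] := fg_subgroup_basis It_fg.
have [n n0 Itn] : exists2 n, (0 < n)%N & It (vsval t *+ n).
  by rewrite ItE; apply: Zspan_pos_multiple; rewrite -Qspan_Zspan -ItE -UtE subvsP.
have [_ inj _] := It_unimod.
have It0 : It 0 by rewrite ItE; apply: Zspan0.
have /eqP : vsval t *+ n = 0.
  apply: inj; rewrite ?inE //; apply/lfunP => u.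
  by rewrite !pairUE formMl -idUE t0 lfunE mul0rn form0l.
rewrite -scaler_nat scaler_eq0 pnatr_eq0 eqn0Ngt n0 /= => /eqP t00.
by apply: subvs_inj; rewrite t00 raddf0.
Qed.

Lemma pairU_surj (f : dualv (subvs_of U)) : exists v, pairU b U v = f.
Proof.
have [v vE] := riesz (f \o linfun (vsproj U))%VF ndeg.
by exists v; apply/lfunP => u; rewrite pairUE vE comp_lfunE lfunE /= vsvalK.
Qed.

Lemma lattice_pos_multiple v : exists2 n : nat, (0 < n)%N & L (v *+ n).
Proof.
have [e [_ -> efull]] := even_lattice_basis Lev.
by apply: Zspan_pos_multiple; rewrite efull memvf.
Qed.

(** The surjective half of unimodularity, for functionals given by a vector [v] of the whole
    space. *)
Lemma unimodular_lift v : (forall u : subvs_of U, L (vsval u) -> b v (vsval u) \is a Num.int) ->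
  exists2 t : subvs_of Ut, It (vsval t) &
    forall u : subvs_of U, b (vsval t) (vsval u) = b v (vsval u).
Proof.
move=> vI; have [_ _ surj] := It_unimod.
have [|mu Imu muE] := surj (pairU b U v); first by move=> u Iu; rewrite pairUE vI.
exists (vsproj Ut mu); rewrite ?vsprojK ?It_Ut // => u.
by rewrite -!pairUE muE.
Qed.

(** A functional on [U] is the pairing with some [v]. A multiple [v *+ n] is in [L], so it pairs
    with [U] like some [t] in [It], and [t] is divided by [n]. *)
Lemma idU_img : limg (idU b U Ut) = fullv.
Proof.
apply/eqP; rewrite eqEsubv subvf /=; apply/subvP => f _.
have [v <-] := pairU_surj f; have [n n0 Lvn] := lattice_pos_multiple v.
have [|t _ tE] := @unimodular_lift (v *+ n).
  by move=> u; apply: even_lattice_int Lev Lvn.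
apply/memv_imgP; exists (n%:R^-1 *: t); rewrite ?memvf //; apply/lfunP => u.
rewrite linearZ /= scale_lfunE idUE tE formMl pairUE.
have nn0 : n%:R != 0 :> rat by rewrite pnatr_eq0 -lt0n.
by rewrite -[X in _ *: X]mulr_natl; apply/esym; apply: (mulKf nn0).
Qed.

Lemma dim_UtU : \dim {:subvs_of Ut} = \dim {:subvs_of U}.
Proof.
by rewrite -[RHS]dim_dualv -idU_img limg_dim_eq // idU_ker capv0.
Qed.

Lemma idU_VK : cancel (idU b U Ut)^-1%VF (idU b U Ut).
Proof. exact/limgf_invK/idU_img. Qed.
Lemma idU_K : cancel (idU b U Ut) (idU b U Ut)^-1%VF.
Proof. exact/lker0_invK/idU_ker. Qed.

(** [U] and [Wt] are both orthogonal to [U], so the pairing with [U] sees the [Ut]-component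
    alone. *)
Definition T_part : 'Hom(V, subvs_of Ut) := ((idU b U Ut)^-1 \o pairU b U)%VF.

Lemma T_partE v u : b (vsval (T_part v)) (vsval u) = b v (vsval u).
Proof. by rewrite -idUE [T_part v]comp_lfunE idU_VK pairUE. Qed.

Lemma idU'_ker : lker (idU b Ut U) = 0%VS.
Proof.
apply: lker0_intro => u u0; apply: subvs_inj; rewrite raddf0.
apply: (nondegenerate_eq0 ndeg) => v.
by rewrite formC -T_partE formC -idU'E u0 lfunE.
Qed.

Lemma idU'_VK : cancel (idU b Ut U)^-1%VF (idU b Ut U).
Proof.
by apply/limgf_invK/lker0_limgf; [rewrite dim_dualv dim_UtU|apply: idU'_ker].
Qed.
Lemma idU'_K : cancel (idU b Ut U) (idU b Ut U)^-1%VF.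
Proof. exact/lker0_invK/idU'_ker. Qed.

(** [Ut] need not be isotropic, so the [Ut]-component is removed before pairing with [Ut]. *)
Definition U_part : 'Hom(V, subvs_of U) :=
  ((idU b Ut U)^-1 \o pairU b Ut \o (\1 - (linfun (@vsval _ _ Ut) \o T_part)))%VF.

Lemma U_partE v t : b (vsval (U_part v)) (vsval t) = b (v - vsval (T_part v)) (vsval t).
Proof.
rewrite -idU'E [U_part v]comp_lfunE [X in idU _ _ _ X]comp_lfunE idU'_VK pairUE.
by rewrite add_lfunE opp_lfunE id_lfunE comp_lfunE lfunE.
Qed.

Definition W_part : 'Hom(V, subvs_of Wt) :=
  (linfun (vsproj Wt) \o (\1 - (linfun (@vsval _ _ U) \o U_part)
                             - (linfun (@vsval _ _ Ut) \o T_part)))%VF.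

Lemma W_partE v : vsval (W_part v) = v - vsval (U_part v) - vsval (T_part v).
Proof.
rewrite [W_part v]comp_lfunE lfunE !(add_lfunE, opp_lfunE, id_lfunE).
rewrite [(linfun _ \o U_part)%VF v]comp_lfunE [(linfun _ \o T_part)%VF v]comp_lfunE.
rewrite [linfun _ (U_part v)]lfunE [linfun _ (T_part v)]lfunE /=.
rewrite vsprojK //; apply/mem_orthovP => x /memv_addP[u uU [t tT ->]].
rewrite -(vsprojK uU) -(vsprojK tT) !formE T_partE form_UU U_partE !formE.
by ring.
Qed.

Lemma decomp v : v = vsval (U_part v) + vsval (W_part v) + vsval (T_part v).
Proof. by rewrite W_partE -addrA subrK addrC subrK. Qed.

Lemma decomp_uniq u w t (v := vsval u + vsval w + vsval t) :
  [/\ U_part v = u, W_part v = w & T_part v = t].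
Proof.
have tcv : T_part v = t.
  have inj : injective (idU b U Ut) by exact: can_inj idU_K.
  apply: inj; apply/lfunP => u'; rewrite !idUE T_partE.
  by rewrite !formDl form_UU form_WU !add0r.
have ucv : U_part v = u.
  have inj : injective (idU b Ut U) by exact: can_inj idU'_K.
  apply: inj; apply/lfunP => t'; rewrite !idU'E U_partE tcv addrK.
  by rewrite !formDl form_WT addr0.
split=> //; apply: subvs_inj; rewrite W_partE tcv ucv.
by rewrite addrAC addrK addrAC subrr add0r.
Qed.

Lemma U_part_U u : U_part (vsval u) = u.
Proof. by have [+ _ _] := decomp_uniq u 0 0; rewrite !raddf0 !addr0. Qed.
Lemma W_part_U u : W_part (vsval u) = 0.
Proof. by have [_ + _] := decomp_uniq u 0 0; rewrite !raddf0 !addr0. Qed.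
Lemma T_part_U u : T_part (vsval u) = 0.
Proof. by have [_ _] := decomp_uniq u 0 0; rewrite !raddf0 !addr0. Qed.
Lemma U_part_W w : U_part (vsval w) = 0.
Proof. by have [+ _ _] := decomp_uniq 0 w 0; rewrite !raddf0 add0r !addr0. Qed.
Lemma W_part_W w : W_part (vsval w) = w.
Proof. by have [_ + _] := decomp_uniq 0 w 0; rewrite !raddf0 add0r !addr0. Qed.
Lemma T_part_W w : T_part (vsval w) = 0.
Proof. by have [_ _] := decomp_uniq 0 w 0; rewrite !raddf0 add0r !addr0. Qed.
Lemma U_part_T t : U_part (vsval t) = 0.
Proof. by have [+ _ _] := decomp_uniq 0 0 t; rewrite !raddf0 !add0r. Qed.
Lemma W_part_T t : W_part (vsval t) = 0.
Proof. by have [_ + _] := decomp_uniq 0 0 t; rewrite !raddf0 !add0r. Qed.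
Lemma T_part_T t : T_part (vsval t) = t.
Proof. by have [_ _] := decomp_uniq 0 0 t; rewrite !raddf0 !add0r. Qed.

Lemma T_part_eq0 v : v \in orthov b U -> T_part v = 0.
Proof.
move=> /mem_orthovP vU; apply: (can_inj idU_K); rewrite linear0; apply/lfunP => u.
by rewrite idUE T_partE lfunE vU // subvsP.
Qed.

Lemma memU_orthov u : vsval u \in orthov b U.
Proof. exact/(subvP Uiso)/subvsP. Qed.
Lemma memW_orthov w : vsval w \in orthov b U.
Proof.
have := subvsP w; rewrite /Defs.Wt => /mem_orthovP h.
by apply/mem_orthovP => u uU; apply: h; apply: (subvP (addvSl _ _)).
Qed.

Local Notation idW := (idW b U Ut).

Lemma idWE w : idW w = red_proj b U (vsval w).
Proof. by rewrite comp_lfunE [linfun _ w]lfunE. Qed.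

Lemma form_idW w w' : redform b U (idW w) (idW w') = b (vsval w) (vsval w').
Proof. by rewrite !idWE redformE ?memW_orthov. Qed.

Lemma red_proj_W_part v : v \in orthov b U -> red_proj b U v = idW (W_part v).
Proof.
move=> vU; rewrite {1}(decomp v) T_part_eq0 // raddf0 addr0 linearD /= idWE.
have /eqP -> : red_proj b U (vsval (U_part v)) == 0.
  by rewrite red_proj_eq0 ?subvsP ?memU_orthov.
by rewrite add0r.
Qed.

Lemma idW_ker : lker idW = 0%VS.
Proof.
apply: lker0_intro => w /eqP; rewrite idWE red_proj_eq0 ?memW_orthov // => wU.
by rewrite -(W_part_W w) -(vsprojK wU) W_part_U.
Qed.

Lemma idW_img : limg idW = fullv.
Proof.
apply/eqP; rewrite eqEsubv subvf /=; apply/subvP => x _.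
have [v vU <-] := red_proj_surj x; rewrite red_proj_W_part //.
exact/memv_img/memvf.
Qed.

Lemma idW_VK : cancel idW^-1%VF idW. Proof. exact/limgf_invK/idW_img. Qed.
Lemma idW_K : cancel idW idW^-1%VF. Proof. exact/lker0_invK/idW_ker. Qed.

Lemma redform_eq0 x : (forall y, redform b U x y = 0) -> x = 0.
Proof.
rewrite -(idW_VK x); set w := idW^-1%VF x => w0; suff -> : w = 0 by rewrite linear0.
apply: subvs_inj; rewrite raddf0; apply: (nondegenerate_eq0 ndeg) => v.
by rewrite (decomp v) !formDr form_WU form_WT add0r addr0 -form_idW w0.
Qed.

Lemma redform_nondegenerate : nondegenerate (redform b U : {symmetric W}).
Proof.
rewrite /nondegenerate -subv0; apply/subvP => x /mem_orthovP x0.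
by rewrite memv0; apply/eqP/redform_eq0 => y; apply: x0; rewrite memvf.
Qed.

Lemma It_T_part v : Ld v -> It (vsval (T_part v)).
Proof.
move=> Lv; have [|t It_t tE] := @unimodular_lift v; first by move=> u; apply: Lv.
suff -> : T_part v = t by [].
apply: (can_inj idU_K); apply/lfunP => u.
by rewrite !idUE T_partE tE.
Qed.

(** The pairing of [u] with [y] in the dual lattice only sees [T_part y], which is in [It]; double
    duality then makes [It] a sufficient test. *)
Lemma lattice_U u : (forall t : subvs_of Ut, It (vsval t) -> b (vsval u) (vsval t) \is a Num.int) ->
  L (vsval u).
Proof.
move=> uI; apply: double_dual Lev _ => // y Ly.
by rewrite formC -T_partE formC; apply/uI/It_T_part.
Qed.

(** [It] lies in the dual lattice and is orthogonal to [w], so [u] alone pairs integrally with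
    it. *)
Lemma lattice_UW u w : L (vsval u + vsval w) -> L (vsval u) /\ L (vsval w).
Proof.
move=> Luw; have Lu : L (vsval u).
  apply: lattice_U => t It_t; have := It_dual It_t Luw.
  by rewrite formC formDl form_WT addr0.
by split=> //; move: (lattice_sub Luw Lu); rewrite addrAC subrr add0r.
Qed.

Lemma lattice_idW w : redlattice b U L (idW w) <-> L (vsval w).
Proof.
split=> [[v [/= vU Lv]]|Lw].
  rewrite red_proj_W_part // => /(can_inj idW_K) <-.
  by move: Lv; rewrite {1}(decomp v) T_part_eq0 // raddf0 addr0 => /lattice_UW[].
by rewrite idWE; exists (vsval w) => //; split; [apply: memW_orthov|].
Qed.

Definition Lambda_dual w :=
  forall w' : subvs_of Wt, L (vsval w') -> b (vsval w) (vsval w') \is a Num.int.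

Lemma dual_lattice_idW w :
  dual_lattice (redform b U : {symmetric W}) (redlattice b U L) (idW w) <->
  Lambda_dual w.
Proof.
split=> [wL w' Lw'|wL x].
  by rewrite -form_idW; apply/wL/lattice_idW.
by rewrite -(idW_VK x) => /lattice_idW Lx; have := wL _ Lx; rewrite -form_idW.
Qed.


(** * Transported maps, the lift to the dual lattice, and condition (iii) *)

Lemma Ut_pairing_inj t t' : (forall u, b (vsval t) (vsval u) = b (vsval t') (vsval u)) -> t = t'.
Proof. by move=> e; apply: (can_inj idU_K); apply/lfunP => u; rewrite !idUE. Qed.

Lemma U_pairing_inj u u' : (forall t, b (vsval u) (vsval t) = b (vsval u') (vsval t)) -> u = u'.
Proof. by move=> e; apply: (can_inj idU'_K); apply/lfunP => t; rewrite !idU'E. Qed.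

Lemma It_int t : (forall u, L (vsval u) -> b (vsval t) (vsval u) \is a Num.int) ->
  It (vsval t).
Proof. by move=> /unimodular_lift[t' It't tE]; rewrite -(Ut_pairing_inj tE). Qed.

Lemma tilde_UsUsE h t :
  tilde_UsUs b Ut h t = (idU b U Ut)^-1%VF (h (idU b U Ut t)).
Proof. by rewrite /tilde_UsUs !comp_lfunE. Qed.
Lemma tilde_UsUE h t : tilde_UsU b Ut h t = h (idU b U Ut t).
Proof. by rewrite /tilde_UsU comp_lfunE. Qed.
Lemma tilde_UsWE (h : 'Hom(dualv (subvs_of U), W)) t :
  tilde_UsW Ut h t = idW^-1%VF (h (idU b U Ut t)).
Proof. by rewrite /tilde_UsW !comp_lfunE. Qed.
Lemma tilde_WWE (h : 'End(W)) w : tilde_WW Ut h w = idW^-1%VF (h (idW w)).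
Proof. by rewrite /tilde_WW !comp_lfunE. Qed.
Lemma tilde_WUE psi w : tilde_WU Ut psi w = psi (idW w).
Proof. by rewrite /tilde_WU comp_lfunE. Qed.

Section DualMaps.
Variable M : 'End(subvs_of U).

Lemma tMsE t u :
  b (vsval (tilde_UsUs b Ut (dual_map M) t)) (vsval u) = b (vsval t) (vsval (M u)).
Proof.
by rewrite -idUE tilde_UsUsE idU_VK dual_mapE idUE.
Qed.

Hypothesis M0 : lker M = 0%VS.

Lemma param_MK : cancel M (M^-1)%VF. Proof. exact: lker0_invK. Qed.
Lemma param_MVK : cancel (M^-1)%VF M. Proof. exact/limgf_invK/lker0_limgf. Qed.

Lemma tMinvE t u :
  b (vsval (tilde_UsUs b Ut (dual_map M)^-1 t)) (vsval (M u)) = b (vsval t) (vsval u).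
Proof.
rewrite -idUE tilde_UsUsE idU_VK -dual_mapE limgf_invK ?idUE //.
apply/eqP; rewrite eqEsubv subvf; apply/subvP => f _.
apply/memv_imgP; exists (f \o M^-1)%VF; rewrite ?memvf //.
by apply/lfunP => x; rewrite dual_mapE comp_lfunE param_MK.
Qed.

Lemma tMs_tMinv t :
  tilde_UsUs b Ut (dual_map M) (tilde_UsUs b Ut (dual_map M)^-1 t) = t.
Proof. by apply: Ut_pairing_inj => u; rewrite tMsE tMinvE. Qed.

Lemma tMinv_tMs t :
  tilde_UsUs b Ut (dual_map M)^-1 (tilde_UsUs b Ut (dual_map M) t) = t.
Proof. by apply: Ut_pairing_inj => u; rewrite -[u]param_MVK tMinvE tMsE. Qed.

End DualMaps.

Lemma tpsisE psi t w :
  b (vsval (tilde_UsW Ut (psi_dual psi) t)) (vsval w) =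
  b (vsval t) (vsval (psi (idW w))).
Proof.
rewrite -form_idW tilde_UsWE idW_VK.
rewrite -[LHS](@to_dualE _ (redform b U : {symmetric W})) [psi_dual _ _]comp_lfunE.
rewrite limgf_invK ?dual_mapE ?idUE // lker0_limgf ?dim_dualv //.
by apply: nondegenerate_ker => x; apply: redform_eq0.
Qed.

Lemma tgammaE gamma w : idW (tilde_WW Ut gamma w) = gamma (idW w).
Proof. by rewrite tilde_WWE idW_VK. Qed.

(* The projection of [L] to [Ut] is a free abelian group, so it has a linear
   section [s] with values in [L]; then [th w] is defined by pairing [w] with [s]. *)
Lemma dual_lift : exists th : 'Hom(subvs_of Wt, subvs_of U),
  forall w, Lambda_dual w -> Ld (vsval (th w) + vsval w).
Proof.
have [fgL _ _] := Lev.
have [e [e_free eE]] := fg_subgroup_basis (@fg_subgroup_image _ _ T_part L fgL).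
have /choice[l lP] : forall i : 'I_(size e), exists l, L l /\ T_part l = e`_i.
  move=> i; have : Zspan e e`_i by apply/Zspan_mem/mem_nth.
  by rewrite -eE => -[l Ll <-]; exists l.
have [|s sE] := @linear_lfun _ _ (fun t => \sum_(i < size e) coord (in_tuple e) i t *: l i).
  move=> a x y; rewrite scaler_sumr -big_split; apply: eq_bigr => i _ /=.
  by rewrite linearP scalerDl scalerA.
have sL v : L v -> L (s (T_part v)) /\ T_part (s (T_part v)) = T_part v.
  move=> Lv; have : Zspan e (T_part v) by rewrite -eE; exists v.
  move: (T_part v) => t; apply: (@Zspan_min _ _ (fun t => L (s t) /\ T_part (s t) = t)).
  - by rewrite !linear0; split=> //; apply: lattice0.
  - by move=> x y [Lx xE] [Ly yE]; rewrite !linearD /= xE yE; split=> //; apply: lattice_add.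
  - by move=> x [Lx xE]; rewrite !linearN /= xE; split=> //; apply: lattice_opp.
  move=> x /(nthP 0)[i ilt <-]; rewrite sE (bigD1 (Ordinal ilt)) //= big1 ?addr0.
    rewrite (coord_free (Ordinal ilt)) //= eqxx scale1r.
    exact: (lP (Ordinal ilt)).
  move=> j ji; rewrite (coord_free (Ordinal ilt)) //= eq_sym.
  by rewrite (negbTE ji) scale0r.
(* The sign makes [th w + w] orthogonal to [s (T_part v)] for [v] in [L]. The remainder
   [v - s (T_part v)] lies in U^perp, where its pairing with [th w + w] only involves [w] and a
   vector of Lambda. *)
exists (- ((idU b Ut U)^-1 \o dual_map s \o to_dual b \o linfun (@vsval _ _ Wt)))%VF.
move=> w wL v Lv; set u := _ w.
have uE t : b (vsval u) (vsval t) = - b (vsval w) (s t).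
  rewrite /u opp_lfunE 3!comp_lfunE raddfN formNl -idU'E idU'_VK.
  by rewrite dual_mapE to_dualE lfunE.
have [Lsv tcs] := sL v Lv.
have := lattice_sub Lv Lsv; set v' := v - _ => Lv'.
have tcv' : T_part v' = 0 by rewrite linearB /= tcs subrr.
rewrite -(subrK (s (T_part v)) v) -/v' formDr.
have [Lu' Lw'] : L (vsval (U_part v')) /\ L (vsval (W_part v')).
  by apply: lattice_UW; move: Lv'; rewrite {1}(decomp v') tcv' raddf0 addr0.
rewrite {1}(decomp v') tcv' raddf0 addr0.
have -> : b (vsval u + vsval w) (vsval (U_part v') + vsval (W_part v')) =
    b (vsval w) (vsval (W_part v')).
  by rewrite !formE form_UU form_UW form_WU !add0r.
have -> : b (vsval u + vsval w) (s (T_part v)) = 0; last by rewrite addr0 wL.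
rewrite formDl; have -> : b (vsval u) (s (T_part v)) = b (vsval u) (vsval (T_part v)).
  by rewrite [LHS]formC -T_partE tcs formC.
by rewrite uE addNr.
Qed.

(* Condition (iii) with representatives: [- u] represents [iota^* w] whenever
   [u + w] is in [L^*], and every [w] in the dual of [Lambda] has such a [u]. *)
Definition psi_compatible (M : 'End(subvs_of U)) (psi : 'Hom(W, subvs_of U)) :=
  (forall w, L (vsval w) -> L (vsval (psi (idW w)))) /\
  (forall w u, Ld (vsval u + vsval w) -> L (vsval (psi (idW w) + (u - M u)))).

(** This is the pairing of [u + w + w0] in L^* with a vector of [L], after the terms that vanish by
    orthogonality are dropped. *)
Lemma iota_int w w0 w' t u u' :
    L (vsval w0) -> L (vsval u' + vsval w' + vsval t) -> Ld (vsval u + vsval w) ->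
  b (vsval u) (vsval t) + redform b U (idW w + idW w0) (idW w') \is a Num.int.
Proof.
move=> Lw0 Ll Luw; rewrite -linearD form_idW.
have := dual_add Luw (lattice_dual Lw0) Ll; rewrite -addrA -raddfD.
by rewrite !formE form_UU form_UW !form_WU !form_WT !add0r !addr0.
Qed.

Lemma latI0 : latI U L 0.
Proof. by rewrite -[latI U L 0]/(L (vsval (0 : subvs_of U))) raddf0; apply: lattice0. Qed.

Lemma redlattice0 : redlattice b U L 0.
Proof. by rewrite -(linear0 idW); apply/lattice_idW; rewrite raddf0; apply: lattice0. Qed.

Lemma redlattice_idW x : redlattice b U L x -> exists2 w, x = idW w & L (vsval w).
Proof.
by rewrite -(idW_VK x) => /lattice_idW Lx; exists (idW^-1%VF x).
Qed.

(** For [l] in [L], the coset iota of [T_part l] is represented by [W_part l]. Combining the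
    congruence that defines iota^* with the integrality of the pairing of [u + w] and [l] leaves the
    pairing of [u' + u] with [l]. *)
Lemma iota_dualP w u u' : Ld (vsval u + vsval w) ->
  iota_dual Ut L It (cosetv (redlattice b U L) (idW w)) u' <-> Ld (vsval (u' + u)).
Proof.
move=> Luw; split=> [u'D l Ll|Lu' mu delta x].
  have Itl : ItL b U L It (vsval (T_part l)).
    split; first exact/It_T_part/lattice_dual.
    by exists l => // u0 _; rewrite T_partE.
  have iotal : Defs.iota Ut L (vsval (T_part l)) (idW (W_part l)).
    by exists (U_part l), (W_part l); rewrite -decomp.
  have Dw : cosetv (redlattice b U L) (idW w) (idW w).
    by exists 0; [exact: redlattice0|rewrite addr0].
  have int1 := u'D _ _ _ Itl Dw iotal.
  have int2 : b (vsval u) (vsval (T_part l)) + redform b U (idW w) (idW (W_part l)) \is a Num.int.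
    have L00 : L (vsval (0 : subvs_of Wt)) by rewrite raddf0; apply: lattice0.
    have Ll' : L (vsval (U_part l) + vsval (W_part l) + vsval (T_part l)) by rewrite -decomp.
    by have := iota_int L00 Ll' Luw; rewrite (linear0 idW) addr0.
  rewrite formC -T_partE formC raddfD formDl.
  rewrite -(subrK (redform b U (idW w) (idW (W_part l))) (b (vsval u') _)) -addrA.
  by rewrite [redform b U _ _ + _]addrC rpredD.
move=> [Imu [nu Lnu nuE]] [y Ly <-] [u'' [w' [Ll ->]]].
have [w0 -> Lw0] := redlattice_idW Ly.
have muT := It_Ut Imu.
rewrite -(vsprojK muT) in Ll *; set t := vsproj Ut mu in Ll *.
have int1 := iota_int Lw0 Ll Luw.
have int2 : b (vsval (u' + u)) (vsval t) \is a Num.int.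
  by have := Lu' _ Ll; rewrite !formDr form_UU form_UW !add0r.
rewrite -(addrK (b (vsval u) (vsval t)) (b (vsval u') (vsval t))) -formDl -raddfD.
by rewrite -addrA -opprD rpredB.
Qed.

(** Since [Id - M] carries U meet L^* into [I], the choice of [u] is immaterial, and [dual_lift]
    provides one for each [w]. Equality of the two cosets then amounts to one difference lying in
    [I]. *)
Lemma condition_psiP (M : 'End(subvs_of U)) (psi : 'Hom(W, subvs_of U)) :
    (forall u, Ld (vsval u) -> L (vsval (u - M u))) ->
  condition_psi Ut L It M psi <-> psi_compatible M psi.
Proof.
move=> MJ; have [th thL] := dual_lift; split.
  move=> [psiL psiE]; split=> [w Lw|w u Luw].
    by apply: psiL; exists (idW w) => //; apply/lattice_idW.
  have wL : Lambda_dual w.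
    by move=> w' /Luw; rewrite formDl form_UW add0r.
  have : coset_map (latI U L) psi (cosetv (redlattice b U L) (idW w)) (psi (idW w)).
    exists (idW w).
      by exists 0; [exact: redlattice0|rewrite addr0].
    by exists 0; [exact: latI0|rewrite addr0].
  rewrite psiE; last exact/dual_lattice_idW.
  move=> [u' /(iota_dualP _ Luw) Lu' [i Li <-]].
  rewrite add_lfunE opp_lfunE id_lfunE addrAC addrACA -opprD -linearD raddfD.
  by apply: lattice_add => //; apply: MJ.
move=> [psiL psiE]; split=> [_ [_ /redlattice_idW[w -> Lw] <-]|delta].
  exact: psiL.
rewrite -(idW_VK delta); set w := idW^-1%VF delta => /dual_lattice_idW wL.
have Lth := thL w wL; apply/seteqP; split.
  move=> _ [_ [_ /redlattice_idW[w0 -> Lw0] <-] [i Li <-]].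
  exists (- th w).
    by apply/(iota_dualP _ Lth); rewrite addNr raddf0; apply/lattice_dual/lattice0.
  exists (psi (idW w) + (th w - M (th w)) + psi (idW w0) + i).
    rewrite /latI /mkset !raddfD; apply: lattice_add => //.
    by apply: lattice_add; [rewrite -!raddfD; apply: psiE|apply: psiL].
  rewrite add_lfunE opp_lfunE id_lfunE !linearN /=.
  by apply: U_pairing_inj => t; rewrite !(raddfD, raddfN) !formE; ring.
move=> _ [u' /(iota_dualP _ Lth) Lu' [i Li <-]].
exists (idW w).
  by exists 0; [exact: redlattice0|rewrite addr0].
exists ((u' + th w - M (u' + th w)) - (psi (idW w) + (th w - M (th w))) + i).
  rewrite /latI /mkset raddfD; apply: lattice_add => //.
  rewrite raddfB; apply: lattice_sub; last exact: psiE.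
  exact: MJ.
rewrite add_lfunE opp_lfunE id_lfunE linearD /=.
by apply: U_pairing_inj => t; rewrite !(raddfD, raddfN) !formE; ring.
Qed.

(** * The map [alpha] and condition (iv) *)

Variable alpha : 'Hom(subvs_of Ut, subvs_of U).
Hypothesis alphaP : is_alpha b alpha.

Lemma alpha_sym t t' :
  b (vsval t) (vsval (alpha t')) = b (vsval t') (vsval (alpha t)).
Proof. by have [+ _] := alphaP; apply. Qed.

(** Expanding the isotropy of the vectors [t - alpha t]: through the pairing, [alpha] is half the
    form of [Ut]. *)
Lemma form_TT t t' :
  b (vsval t) (vsval t') = b (vsval t) (vsval (alpha t')) *+ 2.
Proof.
have [_ /(_ t t')] := alphaP; rewrite !formE form_UU oppr0 subr0.
rewrite [b (vsval (alpha t)) _]formC -alpha_sym => /eqP.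
by rewrite -addrA -opprD subr_eq0 => /eqP->; rewrite mulr2n.
Qed.

(* The right-hand side of condition (iv) without [kappa]. *)
Definition eta_map (M : 'End(subvs_of U)) (psi : 'Hom(W, subvs_of U)) :
    'Hom(subvs_of Ut, subvs_of U) :=
  let tpsi := tilde_WU Ut psi in
  let tpsis := tilde_UsW Ut (psi_dual psi) in
  let tMs := tilde_UsUs b Ut (dual_map M) in
  ((\1 - M) \o alpha \o (\1 - tMs) + (M \o alpha) - (alpha \o tMs)
       - 2%:R^-1 *: (tpsi \o tpsis))%VF.

(** After expansion the two terms [M (alpha t)] cancel and the two terms [alpha m] add up. *)
Lemma eta_mapE (M : 'End(subvs_of U)) (psi : 'Hom(W, subvs_of U)) t
    (m := tilde_UsUs b Ut (dual_map M) t) :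
  eta_map M psi t = alpha t - alpha m *+ 2 + M (alpha m)
    - 2%:R^-1 *: psi (idW (tilde_UsW Ut (psi_dual psi) t)).
Proof.
rewrite /eta_map eta_map_aux tilde_WUE -/m; apply: U_pairing_inj => t'.
rewrite !(raddfD, raddfN, raddfMn) /= !(raddfD, raddfN, raddfMn) !formE ?formMl.
by ring.
Qed.

Lemma hom_latticeP f :
  hom_lattice (latI U L) f <-> exists2 t, It (vsval t) & f = idU b U Ut t.
Proof.
split=> [fI|[t It_t -> u Lu]]; last first.
  by rewrite idUE; apply: It_dual.
have [v vE] := pairU_surj f.
have [|t It_t tE] := @unimodular_lift v; first by move=> u Lu; rewrite -pairUE vE fI.
by exists t => //; apply/lfunP => u; rewrite idUE tE -pairUE vE.
Qed.

Lemma condition_etaP M psi eta : condition_eta alpha L M psi eta <->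
  forall t, It (vsval t) -> L (vsval (eta_map M psi t - eta (idU b U Ut t))).
Proof.
split=> [[kappa kI /lfunP etaE] t It_t|etaL].
  have -> : eta (idU b U Ut t) = eta_map M psi t - kappa (idU b U Ut t).
    have := etaE t; rewrite tilde_UsUE => ->.
    by rewrite add_lfunE opp_lfunE tilde_UsUE.
  rewrite subKr; apply: (kI).
  by exists (idU b U Ut t) => //; apply/hom_latticeP; exists t.
exists ((eta_map M psi - tilde_UsU b Ut eta) \o (idU b U Ut)^-1)%VF.
  move=> _ [f /hom_latticeP[t It_t ->] <-].
  rewrite /latI /mkset [X in vsval X]comp_lfunE idU_K add_lfunE opp_lfunE.
  by rewrite tilde_UsUE; apply: etaL.
apply/lfunP => t; rewrite [RHS]add_lfunE [X in _ + X]opp_lfunE !tilde_UsUE.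
rewrite [X in _ - X]comp_lfunE idU_K [X in _ - X]add_lfunE [X in _ - (_ + X)]opp_lfunE.
by rewrite tilde_UsUE subKr.
Qed.

(* Since [L] is its double dual, membership can be tested against [L^*], which is
   the sum of [It] and of its part orthogonal to [U]. *)
Lemma lattice_parabolic M psi t : psi_compatible M psi -> It (vsval t) ->
  let v := t - tilde_UsUs b Ut (dual_map M) t in
  L (vsval v + vsval (tilde_UsW Ut (psi_dual psi) t) - vsval (alpha v) *+ 2).
Proof.
move=> [psiL psiE] It_t v.
have vE u : b (vsval v) (vsval u) = b (vsval t) (vsval (u - M u)).
  by rewrite !vsvalB formDl formNl formDr formNr tMsE.
move: v vE => v vE; set w := tilde_UsW _ _ _.
apply: double_dual Lev _ => // y Ly.
have Lty : Ld (vsval (U_part y) + vsval (W_part y)).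
  have := dual_add Ly (dual_opp (It_dual (It_T_part Ly))).
  by rewrite {1}(decomp y) addrK.
(* By [form_TT], [- 2 alpha v] cancels the pairing of [v] with [T_part y]. By adjunction the rest is
   the pairing of [t] with the vector that (iii) places in [L]. *)
have -> : b (vsval v + vsval w - vsval (alpha v) *+ 2) y =
    b (vsval t) (vsval (psi (idW (W_part y)) + (U_part y - M (U_part y)))).
  rewrite [in LHS](decomp y) vsvalD [RHS]formDr -vE -tpsisE -/w.
  rewrite !formDr !formDl !formNl ?formMl ?formDl.
  rewrite form_UU form_UW form_WU form_WT form_TW [b (vsval v) (vsval (T_part y))]form_TT.
  rewrite [b (vsval (alpha v)) _]formC -alpha_sym.
  by ring.
exact/(It_dual It_t)/psiE.
Qed.

Lemma form_inj v v' : (forall y, b v y = b v' y) -> v = v'.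
Proof.
move=> e; apply/eqP; rewrite -subr_eq0; apply/eqP/(nondegenerate_eq0 ndeg) => y.
by rewrite !formE e subrr.
Qed.

(** * Elements of the parabolic subgroup *)

Section ParabolicElement.
Variables (A : 'End(V)) (M : 'End(subvs_of U)) (gamma : 'End(W)).
Variables (psi : 'Hom(W, subvs_of U)) (eta : 'Hom(dualv (subvs_of U), subvs_of U)).
Hypothesis Apar : has_parameters alpha A M gamma psi eta.

Local Notation tgamma := (tilde_WW Ut gamma).
Local Notation tpsis := (tilde_UsW Ut (psi_dual psi)).
Local Notation tMs := (tilde_UsUs b Ut (dual_map M)).
Local Notation tMinv := (tilde_UsUs b Ut (dual_map M)^-1).

Lemma param_M0 : lker M = 0%VS. Proof. by case: Apar => -[]. Qed.
Lemma param_gamma : O_Q (redform b U : {symmetric W}) gamma.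
Proof. by case: Apar => -[]. Qed.
Lemma param_U u : A (vsval u) = vsval (M u). Proof. by case: Apar => _ []. Qed.

Lemma param_W w :
  A (vsval w) = vsval (tgamma w) - vsval (psi (gamma (idW w))).
Proof. by case: Apar => _ [_ -> _]; rewrite tilde_WUE tgammaE. Qed.

(** The substitution t = M^* x brings out the vector of [lattice_parabolic] at [x]; the remainder is
    what [condition_etaP] requires to be in [I]. *)
Lemma param_T t (x := tMinv t) : A (vsval t) - vsval t =
  (vsval (x - t) + vsval (tpsis x) - vsval (alpha (x - t)) *+ 2) +
  vsval (eta_map M psi x - eta (idU b U Ut x)).
Proof.
have xE : tMs x = t by apply/tMs_tMinv/param_M0.
case: Apar => _ [_ _ ->]; rewrite -/x eta_mapE xE tilde_WUE tilde_UsUE.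
move: (tpsis x) => w; rewrite [alpha (x - t)]linearB !(vsvalD, vsvalB, vsvalN, vsvalMn, vsvalZ).
by apply: form_inj => y; rewrite !formE ?mulr1n; ring.
Qed.

Lemma tgamma_iso w w' :
  b (vsval (tgamma w)) (vsval (tgamma w')) = b (vsval w) (vsval w').
Proof. by rewrite -!form_idW !tgammaE; apply: param_gamma. Qed.

Lemma tgamma_surj w : exists w', tgamma w' = w.
Proof.
have [_ gVK] := isometry_bij redform_nondegenerate param_gamma.
exists (idW^-1%VF (gamma^-1%VF (idW w))).
by apply: (can_inj idW_K); rewrite tgammaE idW_VK gVK.
Qed.

Lemma param_UW u w : A (vsval u + vsval w) - (vsval u + vsval w) =
  vsval (M u - u - psi (gamma (idW w))) + vsval (tgamma w - w).
Proof.
have -> : A (vsval u + vsval w) = A (vsval u) + A (vsval w) by exact: linearD.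
rewrite param_U param_W !vsvalB.
by apply: form_inj => y; rewrite !formE; ring.
Qed.


Lemma core_forward : O_Q b A -> A @` L = L ->
    (forall v, Ld v -> L (A v - v)) ->
  [/\ forall w, Lambda_dual w -> L (vsval (tgamma w - w)),
      M @` latI U L = latI U L,
      forall u, Ld (vsval u) -> L (vsval (u - M u)),
      psi_compatible M psi &
      forall t, It (vsval t) -> L (vsval (eta_map M psi t - eta (idU b U Ut t)))].
Proof.
move=> Aiso AL Adual.
have [AK _] := isometry_bij ndeg Aiso.
have gammaL w : Lambda_dual w -> L (vsval (tgamma w - w)).
  move=> wL; have [th thL] := dual_lift.
  by have := Adual _ (thL w wL); rewrite param_UW => /lattice_UW[].
have AL1 v : L v -> L (A v) by move=> Lv; rewrite -AL; exists v.
have MI : M @` latI U L = latI U L.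
  apply/seteqP; split=> [_ [u Lu <-]|u].
    by rewrite /latI /mkset -param_U; apply: AL1.
  rewrite /latI /mkset -{1}AL => -[l Ll lu].
  have MVu := param_MVK param_M0 u.
  exists (M^-1%VF u) => //; rewrite /mkset.
  suff -> : vsval (M^-1%VF u) = l by [].
  by apply: (can_inj AK); rewrite param_U MVu.
have MJ u : Ld (vsval u) -> L (vsval (u - M u)).
  by move=> Lu; rewrite -opprB vsvalN vsvalB -param_U; apply/lattice_opp/Adual.
have psiL w : L (vsval w) -> L (vsval (psi (idW w))).
  (* The vector [w' = gamma^-1 w] is shown to be in Lambda as well. Then [A w' = w - psi w] is in
     [L], which isolates [psi w]. *)
  move=> Lw; have [w' w'E] := tgamma_surj w.
  have Lw' : L (vsval w').
    suff : L (vsval (tgamma w' - w')).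
      by rewrite w'E vsvalB => /(lattice_sub Lw); rewrite subKr.
    apply: (gammaL) => w1 Lw1; rewrite -tgamma_iso w'E; apply: even_lattice_int Lev Lw _.
    have /gammaL : Lambda_dual w1 by move=> w2 Lw2; apply: even_lattice_int Lev Lw1 Lw2.
    by rewrite vsvalB => /(lattice_add Lw1); rewrite addrCA subrr addr0.
  have := Adual (vsval w'); rewrite param_W -tgammaE w'E => /(_ (lattice_dual Lw')).
  by move=> /(lattice_add Lw')/(lattice_sub Lw); rewrite addrCA subrr addr0 subKr.
split=> //; first split=> // w u Luw.
  have wL : Lambda_dual w by move=> w' /Luw; rewrite formDl form_UW add0r.
  have Lg := gammaL w wL.
  have := Adual _ Luw; rewrite param_UW => /lattice_UW[L1 _].
  (* The [U]-component contains [psi (gamma w)] where (iii) has [psi w]; the two differ by [psi] of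
     [gamma w - w], an element of Lambda. *)
  have L2 := psiL _ Lg; have := lattice_opp (lattice_add L1 L2).
  rewrite -vsvalD -vsvalN; congr (L (vsval _)).
  have -> : idW (tgamma w - w) = gamma (idW w) - idW w.
    by rewrite linearB /= tgammaE.
  rewrite [psi (_ - _)]linearB.
  by apply: U_pairing_inj => t; rewrite !(vsvalD, vsvalN) !formE; ring.
(* [A] is applied to [tMs x], so that the remainder in [param_T] is evaluated at the given [x];
   [tMs] preserves [It] because [M] preserves [I]. *)
move=> x It_x; set t := tMs x.
have It_t : It (vsval t).
  apply: It_int => u Lu; rewrite tMsE; apply: It_dual It_x _ _.
  by have : latI U L (M u) by rewrite -MI; exists u.
have xE : tMinv t = x by apply/tMinv_tMs/param_M0.
have := Adual _ (It_dual It_t); rewrite param_T xE; move: (x - t) => v LA.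
(* The first part of [param_T] is orthogonal to [Ut] by [form_TT], so pairing with [It] sees only
   the remainder. *)
apply: lattice_U => t' It_t'; have := It_dual It_t' LA.
rewrite [b (vsval t') _]formC; set k := vsval (eta_map M psi x - _).
have -> : b (vsval v + vsval (tpsis x) - vsval (alpha v) *+ 2 + k) (vsval t') =
          b k (vsval t'); last by [].
rewrite !formDl formNl ?formMl ?formDl form_WT [b (vsval v) _]formC form_TT.
rewrite [b (vsval (alpha v)) _]formC.
by ring.
Qed.

Lemma core_backward :
    (forall w, Lambda_dual w -> L (vsval (tgamma w - w))) ->
    M @` latI U L = latI U L -> psi_compatible M psi ->
    (forall t, It (vsval t) -> L (vsval (eta_map M psi t - eta (idU b U Ut t)))) ->
  forall v, Ld v -> L (A v - v).
Proof.
move=> gammaL MI [psiL psiE] etaL v Lv.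
have It_t := It_T_part Lv.
have : Ld (vsval (U_part v) + vsval (W_part v)).
  have -> : vsval (U_part v) + vsval (W_part v) = v - vsval (T_part v).
    by rewrite W_partE; apply: form_inj => y; rewrite !formE; ring.
  by apply: dual_add => //; exact/dual_opp/It_dual.
rewrite {3 4}(decomp v); move: (U_part v) (W_part v) (T_part v) It_t => u w t It_t Luw.
have wL : Lambda_dual w by move=> w' /Luw; rewrite formDl form_UW add0r.
have Lg := gammaL w wL.
have -> : A (vsval u + vsval w + vsval t) - (vsval u + vsval w + vsval t) =
    (A (vsval u + vsval w) - (vsval u + vsval w)) + (A (vsval t) - vsval t).
  by rewrite [A (_ + vsval t)]linearD opprD addrACA.
have It_x : It (vsval (tMinv t)).
  apply: It_int => u' Lu'; rewrite -[u'](param_MVK param_M0) tMinvE ?param_M0 //.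
  apply: (It_dual It_t).
  have : latI U L u' by []. rewrite -MI => -[u0 Lu0 <-].
  by rewrite param_MK ?param_M0.
apply: lattice_add; last first.
  rewrite param_T; apply: lattice_add; last exact: etaL.
  by have := lattice_parabolic (conj psiL psiE) It_x; rewrite /= tMs_tMinv ?param_M0.
rewrite param_UW; apply: lattice_add => //.
have := lattice_opp (lattice_add (psiE _ _ Luw) (psiL _ Lg)).
rewrite -vsvalD -vsvalN; congr (L (vsval _)).
have -> : idW (tgamma w - w) = gamma (idW w) - idW w.
  by rewrite linearB /= tgammaE.
rewrite [psi (_ - _)]linearB.
by apply: U_pairing_inj => t'; rewrite !(vsvalD, vsvalN) !formE; ring.
Qed.

End ParabolicElement.

(** * Existence of psi and eta *)

(** With [psi = (M - 1) th], the vector of (iii) is [Id - M] applied to [u - th w], and this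
    argument is in L^* as the difference of [u + w] and [th w + w]. For [w] in Lambda, [th w] itself
    is in L^*. *)
Lemma psi_exists (M : 'End(subvs_of U)) :
    (forall u, Ld (vsval u) -> L (vsval (u - M u))) ->
  exists psi : 'Hom(W, subvs_of U), psi_compatible M psi.
Proof.
move=> MJ; have [th thL] := dual_lift.
exists (((M - \1) \o th) \o idW^-1)%VF.
have psiE w : (((M - \1) \o th) \o idW^-1)%VF (idW w) = M (th w) - th w.
  by rewrite comp_lfunE idW_K comp_lfunE add_lfunE opp_lfunE id_lfunE.
split=> [w Lw|w u Luw]; rewrite psiE.
  have Lth : Ld (vsval (th w)).
    have -> : vsval (th w) = (vsval (th w) + vsval w) - vsval w by rewrite addrK.
    apply: dual_add; last exact/dual_opp/lattice_dual.
    by apply: thL => w' Lw'; apply: even_lattice_int Lev Lw Lw'.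
  by rewrite -opprB vsvalN; apply/lattice_opp/MJ.
have wL : Lambda_dual w by move=> w' /Luw; rewrite formDl form_UW add0r.
have := dual_add Luw (dual_opp (thL w wL)); rewrite opprD addrACA subrr addr0 -vsvalB => /MJ.
congr (L (vsval _)); rewrite [M (u - _)]linearB.
by apply: U_pairing_inj => t; rewrite !(vsvalD, vsvalN) !formE; ring.
Qed.

Lemma It_basis : exists e : seq (subvs_of Ut),
  free e /\ forall t, It (vsval t) <-> Zspan e t.
Proof.
have [e [e_free eE]] := fg_subgroup_basis (@fg_subgroup_image _ _ (vsproj Ut) It It_fg).
exists e; split=> // t; rewrite -eE; split=> [It_t|[v It_v <-]].
  by exists (vsval t) => //; apply: vsvalK.
by rewrite vsprojK // It_Ut.
Qed.

Lemma It_pos_multiple t : exists2 n, (0 < n)%N & It (vsval t *+ n).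
Proof.
have [e [_ ItE]] := fg_subgroup_basis It_fg.
rewrite ItE; apply: Zspan_pos_multiple.
by rewrite -Qspan_Zspan -ItE -UtE subvsP.
Qed.

Lemma form_map (h : subvs_of Ut -> subvs_of Ut -> rat^o) :
  (forall y, linear (h^~ y)) -> (forall x, linear (h x)) ->
  exists k : 'Hom(subvs_of Ut, subvs_of U),
    forall x y, b (vsval x) (vsval (k y)) = h x y.
Proof.
move=> hl hr.
have /choice[k kE] : forall y, exists u : subvs_of U,
    forall x : subvs_of Ut, b (vsval x) (vsval u) = h x y.
  move=> y; have [f fE] := linear_lfun (hl y).
  by exists ((idU b Ut U)^-1%VF f) => x; rewrite formC -idU'E idU'_VK fE.
have [|k' k'E] := @linear_lfun _ _ k.
  move=> a x y; apply: U_pairing_inj => t.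
  by rewrite vsvalD vsvalZ !formE ![b (vsval (k _)) _]formC !kE hr.
by exists k' => x y; rewrite k'E.
Qed.

(* The diagonal values of [h] being integral, the integral form with the upper
   triangular matrix of [h + h^T], diagonal halved, has the same symmetrization. *)
Lemma integral_symmetrization (h : subvs_of Ut -> subvs_of Ut -> rat^o) :
    (forall y, linear (h^~ y)) -> (forall x, linear (h x)) ->
    (forall x, It (vsval x) -> h x x \is a Num.int) ->
  exists k : 'Hom(subvs_of Ut, subvs_of U),
    (forall t, It (vsval t) -> L (vsval (k t))) /\
    forall x y, b (vsval x) (vsval (k y)) + b (vsval y) (vsval (k x)) =
                h x y + h y x.
Proof.
move=> hl hr hint; have [e [e_free eP]] := It_basis.
have hDl x y z : h (x + y) z = h x z + h y z.
  by have := hl z 1 x y; rewrite !scale1r.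
have hDr x y z : h z (x + y) = h z x + h z y.
  by have := hr z 1 x y; rewrite !scale1r.
have h0l z : h 0 z = 0 by apply: (addIr (h 0 z)); rewrite -hDl !add0r.
have h0r z : h z 0 = 0 by apply: (addIr (h z 0)); rewrite -hDr !add0r.
have hZl a x z : h (a *: x) z = a * h x z.
  by have := hl z a x 0; rewrite h0l !addr0.
have hZr a x z : h z (a *: x) = a * h z x.
  by have := hr z a x 0; rewrite h0r !addr0.
have hsuml (F : 'I_(size e) -> subvs_of Ut) z : h (\sum_i F i) z = \sum_i h (F i) z.
  by elim/big_rec2: _ => [|i x y _ <-]; rewrite ?h0l ?hDl.
have hsumr (F : 'I_(size e) -> subvs_of Ut) z : h z (\sum_i F i) = \sum_i h z (F i).
  by elim/big_rec2: _ => [|i x y _ <-]; rewrite ?h0r ?hDr.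
pose c := coord (in_tuple e).
have cE t : t = \sum_i c i t *: e`_i.
  apply: (@coord_span _ _ _ (in_tuple e)).
  have [n n0] := It_pos_multiple t; rewrite -vsvalMn => /eP/Zspan_span.
  by rewrite -scaler_nat rpredZeq pnatr_eq0 eqn0Ngt n0.
have eI (i : 'I_(size e)) : It (vsval e`_i) by apply/eP/Zspan_mem/mem_nth.
have cI i t : It (vsval t) -> c i t \is a Num.int.
  move=> /eP; apply: (@Zspan_min _ _ (fun t => c i t \is a Num.int)).
  - by rewrite /c linear0.
  - by move=> x y; rewrite /c linearD; apply: rpredD.
  - by move=> x; rewrite /c linearN rpredN.
  by move=> x /(nthP 0)[j jlt <-]; rewrite /c (coord_free (Ordinal jlt)).
pose K (i j : 'I_(size e)) : rat :=
  if (i < j)%N then h e`_i e`_j + h e`_j e`_i else if i == j then h e`_i e`_i else 0.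
have KI i j : K i j \is a Num.int.
  rewrite /K; case: ifP => _; last by case: ifP => // _; apply: hint.
  (* Off the diagonal, polarization expresses the entry through diagonal values of [h] on [It]. *)
  have -> : h e`_i e`_j + h e`_j e`_i =
      h (e`_i + e`_j) (e`_i + e`_j) - h e`_i e`_i - h e`_j e`_j.
    by rewrite hDl !hDr; ring.
  rewrite !rpredB ?hint //; first by apply/eP/ZspanD; apply/eP.
have KE i j : K i j + K j i = h e`_i e`_j + h e`_j e`_i.
  rewrite /K; case: ltngtP => ij.
  - by rewrite [j == i]eq_sym -val_eqE ltn_eqF // addr0.
  - by rewrite -val_eqE gtn_eqF // add0r addrC.
  by rewrite (val_inj ij) eqxx.
pose H (x y : subvs_of Ut) : rat^o := \sum_i \sum_j K i j * (c i x * c j y).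
have [y a x x'|x a y y'|k kE] := @form_map H.
- rewrite /H scaler_sumr -big_split; apply: eq_bigr => i _ /=.
  rewrite scaler_sumr -big_split; apply: eq_bigr => j _ /=.
  by rewrite /c linearP /= -[_ *: _]/(_ * _); ring.
- rewrite /H scaler_sumr -big_split; apply: eq_bigr => i _ /=.
  rewrite scaler_sumr -big_split; apply: eq_bigr => j _ /=.
  by rewrite /c linearP /= -[_ *: _]/(_ * _); ring.
exists k; split=> [t It_t|x y].
  apply: lattice_U => t' It_t'; rewrite formC kE.
  apply: rpred_sum => i _; apply: rpred_sum => j _.
  by rewrite !rpredM ?KI ?cI.
have HE : h x y + h y x = \sum_i \sum_j (c i x * c j y) * (K i j + K j i).
  rewrite {1 2}(cE x) {1 2}(cE y) !hsuml.
  rewrite [X in _ + X](eq_bigr (fun i => \sum_j h (c i y *: e`_i) (c j x *: e`_j))) //.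
    rewrite exchange_big -big_split; apply: eq_bigr => i _.
    rewrite hsumr -big_split; apply: eq_bigr => j _ /=.
    by rewrite KE !hZl !hZr; ring.
rewrite HE !kE /H [X in _ + X]exchange_big -big_split; apply: eq_bigr => i _ /=.
by rewrite -big_split; apply: eq_bigr => j _ /=; ring.
Qed.

(** The map is [eta_map - k]: antisymmetry asks that [k] have the same symmetrization as [eta_map],
    and (iv) asks that [k] send [It] into [I]. *)
Lemma eta_exists M psi : psi_compatible M psi ->
  exists eta : 'Hom(dualv (subvs_of U), subvs_of U), antisymmetric_map eta /\
    forall t, It (vsval t) -> L (vsval (eta_map M psi t - eta (idU b U Ut t))).
Proof.
move=> Mpsi; pose h (x y : subvs_of Ut) : rat^o := b (vsval x) (vsval (eta_map M psi y)).
have hl y : linear (h^~ y).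
  by move=> a x x'; rewrite /h vsvalD vsvalZ !formE.
have hr x : linear (h x).
  by move=> a y y'; rewrite /h linearP vsvalD vsvalZ !formE.
have [x It_x|k [kL kE]] := integral_symmetrization hl hr.
  have Lz : L (vsval (x - tilde_UsUs b Ut (dual_map M) x) +
      vsval (tilde_UsW Ut (psi_dual psi) x) -
      vsval (alpha (x - tilde_UsUs b Ut (dual_map M) x)) *+ 2).
    exact: lattice_parabolic Mpsi It_x.
  move: Lz; have := tpsisE psi x; have := eta_mapE M psi x; have := tMsE M x.
  set m := tilde_UsUs _ _ _ _; set w := tilde_UsW _ _ _ => mE etaE wE.
  have vE : b (vsval (x - m)) (vsval (alpha (x - m))) =
      b (vsval x) (vsval (alpha x)) - b (vsval x) (vsval (alpha m)) *+ 2 +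
      b (vsval m) (vsval (alpha m)).
    rewrite [alpha (x - m)]linearB !vsvalB !formE [b (vsval m) _]alpha_sym; ring.
  have vv := form_TT (x - m) (x - m).
  move: (x - m) vE vv => v vE vv Lz; have [_ _ /(_ _ Lz)[n nE]] := Lev.
  (* [h x x] is minus half the norm of the vector in [Lz]: that norm is the norm of [w] minus twice
     the pairing of [v] with [alpha v], and it equals [2 n]. *)
  have -> : h x x = (- n)%:~R; last exact: rpred_int.
  have n2 : (n *+ 2)%:~R = n%:~R *+ 2 :> rat by rewrite rmorphMn.
  apply: (@mulIf _ 2%:R) => //; rewrite intrN mulNr !mulr_natr -n2 -nE /h etaE.
  rewrite !(vsvalB, vsvalD, vsvalMn, vsvalZ) !formE -mE -wE.
  rewrite form_WT form_TW form_UW form_WU form_UU.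
  rewrite [b (vsval (alpha v)) (vsval v)]formC vv vE.
  by field.
have cE y : ((eta_map M psi - k) \o (idU b U Ut)^-1)%VF (idU b U Ut y) =
    eta_map M psi y - k y.
  by rewrite comp_lfunE idU_K add_lfunE opp_lfunE.
exists ((eta_map M psi - k) \o (idU b U Ut)^-1)%VF; split=> [f g|t It_t].
  rewrite -(idU_VK f) -(idU_VK g); set x := _^-1%VF f; set y := _^-1%VF g.
  rewrite !cE !idUE !vsvalB !formDr !formNr.
  have e0 := kE x y; apply/eqP; rewrite -subr_eq0; apply/eqP.
  rewrite opprK addrACA -opprD e0; exact: subrr.
by rewrite cE subKr; apply: kL.
Qed.

Lemma eta_difference (M : 'End(subvs_of U)) (psi : 'Hom(W, subvs_of U)) eta :
    antisymmetric_map eta ->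
    condition_eta alpha L M psi eta ->
  forall eta', antisymmetric_map eta' /\ condition_eta alpha L M psi eta' <->
    antisymmetric_map (eta' - eta) /\ HomI U L (eta' - eta).
Proof.
move=> eta_anti /condition_etaP etaL eta'.
have antiP : antisymmetric_map eta' <-> antisymmetric_map (eta' - eta).
  split=> anti f g.
    by rewrite !add_lfunE !opp_lfunE !linearB /= anti eta_anti; ring.
  have := anti f g; rewrite !add_lfunE !opp_lfunE !linearB /= => e.
  by rewrite -(subrK (f (eta g)) (f (eta' g))) e eta_anti; ring.
have LP : condition_eta alpha L M psi eta' <-> HomI U L (eta' - eta).
  split=> [/condition_etaP etaL' _ [f /hom_latticeP[t It_t ->] <-]|kI].
    have := lattice_sub (etaL _ It_t) (etaL' _ It_t); rewrite -vsvalB.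
    by rewrite opprD opprK addrACA subrr add0r addrC add_lfunE opp_lfunE.
  apply/condition_etaP => t It_t.
  have : latI U L ((eta' - eta) (idU b U Ut t)).
    by apply: kI; exists (idU b U Ut t) => //; apply/hom_latticeP; exists t.
  move=> /(lattice_sub (etaL _ It_t)); rewrite -vsvalB add_lfunE opp_lfunE.
  by rewrite opprB addrA subrK.
by rewrite antiP LP.
Qed.

(** * Connected components of the real points *)

Section RealPointsOfParabolic.
Variable R : realType.

Local Notation bW := (redform b U : {symmetric W}).
Local Notation G := (real_gram R b).
Local Notation GW := (real_gram R bW).
Local Notation iU := (linfun (@vsval _ _ U)).
Local Notation iW := (linfun (@vsval _ _ Wt) \o idW^-1)%VF.
Local Notation iT := (linfun (@vsval _ _ Ut)).
Local Notation rU := (rmx R iU).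
Local Notation rU' := (rmx R (linfun (vsproj U))).
Local Notation rW := (rmx R iW).
Local Notation rW' := (rmx R (idW \o W_part)%VF).
Local Notation pU := (rmx R (iU \o U_part)%VF).
Local Notation pT := (rmx R (iT \o T_part)%VF).

Lemma embed_WE x : iW x = vsval (idW^-1%VF x).
Proof. by rewrite comp_lfunE linfun_vsvalE. Qed.

Lemma real_subspaceE : real_subspace R U = rmx R (projv U).
Proof. by []. Qed.

Lemma real_subspace_eqmx : (real_subspace R U :=: rU)%MS.
Proof.
rewrite real_subspaceE; apply/eqmxP/andP; split.
  have -> : projv U = (iU \o (linfun (vsproj U) \o projv U))%VF.
    by apply/lfunP => v; rewrite 2!comp_lfunE linfun_vsvalE linfun_vsprojE vsprojK // memv_proj.
  by rewrite rmx_comp submxMl.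
have -> : rU = rmx R (projv U \o iU)%VF.
  congr (rmx R _); apply/lfunP => u.
  by rewrite comp_lfunE linfun_vsvalE projv_id // subvsP.
by rewrite rmx_comp submxMl.
Qed.

Lemma rUK : rU *m rU' = 1%:M.
Proof.
rewrite -rmx_comp -rmx1; congr (rmx R _); apply/lfunP => u.
by rewrite comp_lfunE linfun_vsvalE linfun_vsprojE vsvalK id_lfunE.
Qed.

Lemma rWK : rW *m rW' = 1%:M.
Proof.
rewrite -rmx_comp -rmx1; congr (rmx R _); apply/lfunP => x.
by rewrite comp_lfunE embed_WE comp_lfunE W_part_W idW_VK id_lfunE.
Qed.

(** [X] is the restriction of [g] to the real points of [U], and [Y] is its inverse; both exist
    because [g] maps the row space of [rU] onto itself. *)
Lemma P_R_rU g : P_R b U g -> exists2 X, rU *m g = X *m rU & exists Y, rU = Y *m (rU *m g).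
Proof.
move=> [_ /eqmxP Sg].
have e : (rU *m g :=: rU)%MS.
  apply: eqmx_trans (real_subspace_eqmx); apply: eqmx_trans Sg.
  exact: eqmxMr (eqmx_sym real_subspace_eqmx).
have /submxP[X XE] : (rU *m g <= rU)%MS by rewrite e.
have /submxP[Y YE] : (rU <= rU *m g)%MS by rewrite e.
by exists X => //; exists Y.
Qed.

Lemma P_R_det g : P_R b U g -> \det (rU *m g *m rU') != 0.
Proof.
move=> /P_R_rU[X gX [Y YE]].
have : Y *m (rU *m g *m rU') = 1%:M by rewrite mulmxA -YE rUK.
move=> /(congr1 determinant); rewrite det_mulmx det1 => e.
by apply/eqP => d0; move/eqP: e; rewrite d0 mulr0 eq_sym oner_eq0.
Qed.

Lemma P0_R_det g : P0_R b U g -> 0 < \det (rU *m g *m rU').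
Proof.
apply: (@connected_component_gt0 _ _ (fun g => \det (rU *m g *m rU')) (P_R b U)).
- move=> x; apply: (@continuous_comp _ _ _ (fun g => rU *m g *m rU') (fun X => \det X)).
    exact: continuous_mulmx_const.
  exact: continuous_det.
- exact: P_R_det.
- by rewrite mulmx1 rUK det1.
Qed.

Lemma pUE v : (iU \o U_part)%VF v = vsval (U_part v).
Proof. by rewrite comp_lfunE linfun_vsvalE. Qed.
Lemma pTE v : (iT \o T_part)%VF v = vsval (T_part v).
Proof. by rewrite comp_lfunE linfun_vsvalE. Qed.
Lemma pWE v : (iW \o (idW \o W_part))%VF v = vsval (W_part v).
Proof. by rewrite comp_lfunE embed_WE comp_lfunE idW_K. Qed.

(* Over the rationals the [Ut]-component is a linear function of the pairing with
   [U]; the corresponding matrix identity also holds over [R]. *)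
Lemma orthogonal_T_part k (Z : 'M[R]_(k, _)) : Z *m G *m rU^T = 0 -> Z *m pT = 0.
Proof.
pose e := vbasis {:subvs_of U}.
have [|phi phiE] := @linear_lfun _ _
    (fun v => \sum_(j < \dim {:subvs_of U}) b v (vsval e`_j) *: e`_j).
  move=> a x y; rewrite scaler_sumr -big_split; apply: eq_bigr => j _ /=.
  by rewrite !formE scalerDl scalerA.
have coordphi v (j : 'I_(\dim {:subvs_of U})) : coord e j (phi v) = b v (vsval e`_j).
  by rewrite phiE coord_sum_free // (basis_free (vbasisP _)).
have rphi : rmx R phi = G *m rU^T.
  apply/matrixP => i j; rewrite -[G]mul1mx -[1%:M]rmx1 rmx_gramE rmxE coordphi.
  by rewrite id_lfunE linfun_vsvalE.
(* [T_part] vanishes on the kernel of [phi], so it factors through [phi], the pseudo-inverse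
   supplying the factor. *)
have -> : pT = rmx R ((iT \o T_part \o phi^-1) \o phi)%VF.
  congr (rmx R _); apply/lfunP => v; rewrite [RHS]comp_lfunE [RHS]comp_lfunE.
  rewrite !pTE; congr vsval; apply/eqP; rewrite -subr_eq0; apply/eqP.
  have -> : T_part v - T_part (phi^-1%VF (phi v)) = T_part (v - phi^-1%VF (phi v)).
    by rewrite linearB.
  have : phi (v - phi^-1%VF (phi v)) = 0.
    by rewrite linearB /= limg_lfunVK ?subrr // memv_img ?memvf.
  move: (v - _) => z z0.
  apply: Ut_pairing_inj => u; rewrite T_partE raddf0 form0l.
  rewrite (coord_vbasis (memvf u)) raddf_sum form_sumr big1 // => j _.
  by rewrite [LHS]formZr -coordphi z0 linear0 mulr0.
by rewrite rmx_comp rphi !mulmxA => ->; rewrite mul0mx.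
Qed.

Local Notation pW := (rmx R (iW \o (idW \o W_part))%VF).
Local Notation pUT := (rmx R ((iU \o U_part) + (iT \o T_part))%VF).

Lemma pUTE v : ((iU \o U_part) + (iT \o T_part))%VF v = vsval (U_part v) + vsval (T_part v).
Proof. by rewrite add_lfunE pUE pTE. Qed.
Lemma rW'E v : (idW \o W_part)%VF v = idW (W_part v).
Proof. by rewrite comp_lfunE. Qed.

Lemma pUTW : pUT + pW = 1%:M.
Proof.
rewrite -rmxD -rmx1; congr (rmx R _); apply/lfunP => v.
by rewrite add_lfunE pUTE pWE id_lfunE [RHS]decomp addrAC.
Qed.

Lemma gram_rW : rW *m G *m rW^T = GW.
Proof.
have -> : GW = rmx R (\1%VF : 'End(W)) *m GW *m (rmx R (\1%VF : 'End(W)))^T.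
  by rewrite rmx1 trmx1 mul1mx mulmx1.
apply: rmx_gram_eq => x y.
by rewrite !embed_WE !id_lfunE -form_idW !idW_VK.
Qed.

Lemma gram_rW' : rW' *m GW *m rW'^T = pW *m G *m pW^T.
Proof. by apply: rmx_gram_eq => x y; rewrite !pWE !rW'E -form_idW. Qed.

(** As [g] preserves the real points of [U], it preserves their orthogonal complement, so [rW *m g]
    has no [Ut]-component. Its [U]-component does not affect the form, and the form of [W] is
    left. *)
Lemma P_R_rW g : P_R b U g -> O_R bW (rW *m g *m rW').
Proof.
move=> Pg; have [_ _ [Y YE]] := P_R_rU Pg; have [/= gG _] := Pg.
have rWg : rW *m g *m G *m g^T = rW *m G.
  by rewrite -(mulmxA rW g) -(mulmxA rW (g *m G)) gG.
have Z0 : (rW *m g) *m G *m rU^T = 0.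
  rewrite {1}YE !trmx_mul !mulmxA rWg rmx_gram0 ?mul0mx // => x u.
  by rewrite embed_WE linfun_vsvalE form_WU.
have ZE : rW *m g = rW *m g *m rmx R ((iU \o U_part) + (iW \o (idW \o W_part)))%VF.
  by rewrite -[LHS]mulmx1 -pUTW !rmxD !mulmxDr (orthogonal_T_part Z0) addr0.
rewrite /O_R /mkset trmx_mul mulmxA -[_ *m rW' *m GW]mulmxA -[_ *m rW'^T]mulmxA gram_rW'.
have <- : rmx R ((iU \o U_part) + (iW \o (idW \o W_part)))%VF *m G *m
    (rmx R ((iU \o U_part) + (iW \o (idW \o W_part)))%VF)^T = pW *m G *m pW^T.
  apply: rmx_gram_eq => x y; rewrite !add_lfunE !pUE !pWE.
  by rewrite !formE form_UU form_UW form_WU !add0r.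
rewrite !mulmxA -ZE -mulmxA -trmx_mul -ZE.
by rewrite trmx_mul !mulmxA rWg gram_rW.
Qed.

Lemma P0_R_rW g : P0_R b U g -> SOplus_R bW (rW *m g *m rW').
Proof.
rewrite /SOplus_R -rWK -{1}(mulmx1 rW).
apply: (@connected_component_image _ _ (fun g => rW *m g *m rW') (P_R b U)).
  exact: continuous_mulmx_const.
exact: P_R_rW.
Qed.

(** The section of the action on [W]: it acts by [h] on the real points of [Wt] and by the identity
    on those of [U] and [Ut]. *)
Definition real_embed h : 'M[R]_(\dim {:V}) := pUT + rW' *m h *m rW.

Lemma real_embed1 : real_embed 1%:M = 1%:M.
Proof. by rewrite /real_embed mulmx1 -rmx_comp pUTW. Qed.

Lemma rU_embed h : rU *m real_embed h = rU.
Proof.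
rewrite mulmxDr !mulmxA -!rmx_comp.
have -> : ((idW \o W_part) \o iU)%VF = 0.
  by apply/lfunP => u; rewrite comp_lfunE rW'E linfun_vsvalE W_part_U zero_lfunE linear0.
rewrite rmx0 !mul0mx addr0; congr (rmx R _); apply/lfunP => u.
by rewrite comp_lfunE pUTE linfun_vsvalE U_part_U T_part_U vsval0 addr0.
Qed.

Lemma P_R_embed h : O_R bW h -> P_R b U (real_embed h).
Proof.
move=> hO; split; last first.
  apply/eqmxP; apply: eqmx_trans (eqmxMr _ real_subspace_eqmx) _.
  by rewrite rU_embed; apply: eqmx_sym real_subspace_eqmx.
rewrite /O_R /mkset /real_embed linearD /= !trmx_mul mulmxDl mulmxDr !mulmxDl.
have -> : pUT *m G *m (rW^T *m (h^T *m rW'^T)) = 0.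
  rewrite mulmxA rmx_gram0 ?mul0mx // => x y.
  by rewrite pUTE embed_WE !formE form_UW form_TW addr0.
have -> : rW' *m h *m rW *m G *m pUT^T = 0.
  rewrite -!mulmxA [rW *m _]mulmxA rmx_gram0 ?mulmx0 // => x y.
  by rewrite pUTE embed_WE !formE form_WU form_WT addr0.
rewrite addr0 add0r.
have -> : rW' *m h *m rW *m G *m (rW^T *m (h^T *m rW'^T)) = pW *m G *m pW^T.
  rewrite -gram_rW' -[in RHS]hO -gram_rW; by rewrite !mulmxA.
apply/matrixP => i j; rewrite mxE !rmx_gramE [RHS]mxE -rmorphD; congr ratr.
rewrite !pUTE !pWE [in RHS](decomp (vbasis {:V})`_i) [in RHS](decomp (vbasis {:V})`_j).
rewrite !formE form_UW form_TW form_WU form_WT; by ring.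
Qed.

Lemma P_R_mul (g g' : 'M[R]_(\dim {:V})) : P_R b U g -> P_R b U g' -> P_R b U (g *m g').
Proof.
move=> [gG /eqmxP gS] [g'G /eqmxP g'S]; split.
  exact: O_R_mul.
by apply/eqmxP; rewrite mulmxA; apply: eqmx_trans (eqmxMr _ gS) g'S.
Qed.

(** The map [h -> real_embed (h *m c) *m a] starts at [a] for [h = h0], and carries a connected set
    joining [h0] to [h1] into the real parabolic group. It is applied with the matrices of [gamma']
    and [gamma], [c] being the inverse of the former. *)
Lemma P0_R_embed (a : 'M[R]_(\dim {:V})) h0 h1 c : P0_R b U a -> SOplus_R bW h0 -> SOplus_R bW h1 ->
  (forall h, O_R bW h -> O_R bW (h *m c)) -> h0 *m c = 1%:M ->
  P0_R b U (real_embed (h1 *m c) *m a).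
Proof.
move=> Pa S0 S1 cO hc.
apply: (connected_component_trans Pa).
have {1}-> : a = real_embed (h0 *m c) *m a by rewrite hc real_embed1 mul1mx.
pose f (h : 'M[R]_(\dim {:W})) := real_embed (h *m c) *m a.
apply: (@connected_component_image _ _ f (O_R bW) _ h0 h1).
- have E h : real_embed (h *m c) *m a = pUT *m a + rW' *m h *m (c *m rW *m a).
    by rewrite mulmxDl !mulmxA.
  have -> : f = (fun h => pUT *m a + rW' *m h *m (c *m rW *m a)) by apply/funext.
  exact/continuous_addmx_const/continuous_mulmx_const.
- move=> h hO; apply: P_R_mul; first exact/P_R_embed/cO.
  exact: connected_component_sub Pa.
exact: connected_component_trans (connected_component_sym S0) S1.
Qed.

Section RealParameters.
Variables (A : 'End(V)) (M : 'End(subvs_of U)) (gamma : 'End(W)).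
Variables (psi : 'Hom(W, subvs_of U)) (eta : 'Hom(dualv (subvs_of U), subvs_of U)).
Hypothesis Apar : has_parameters alpha A M gamma psi eta.

Lemma real_mx_U : rU *m real_mx R A *m rU' = rmx R M.
Proof.
rewrite -!rmx_comp; congr (rmx R _); apply/lfunP => u.
by rewrite 2!comp_lfunE linfun_vsvalE linfun_vsprojE (param_U Apar) vsvalK.
Qed.

Lemma real_mx_W : rW *m real_mx R A *m rW' = real_mx R gamma.
Proof.
rewrite -!rmx_comp; congr (rmx R _); apply/lfunP => x.
rewrite comp_lfunE rW'E comp_lfunE embed_WE (param_W Apar) linearB /= W_part_W W_part_U subr0.
by rewrite tgammaE idW_VK.
Qed.

Lemma param_det_gt0 : P0_R b U (real_mx R A) -> 0 < lfun_det M.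
Proof. by move=> /P0_R_det; rewrite real_mx_U det_rmx ltr0q. Qed.

Lemma param_SOplus : P0_R b U (real_mx R A) -> SOplus_R bW (real_mx R gamma).
Proof. by move=> /P0_R_rW; rewrite real_mx_W. Qed.

End RealParameters.

End RealPointsOfParabolic.

(** * The determinant on [I], the equivalence, and the change of [gamma] *)

Lemma latI_basis : exists s : seq (subvs_of U),
  [/\ free s, latI U L = Zspan s & span s = fullv].
Proof.
have [fgL _ _] := Lev.
(* By [form_TT], v_U + 2 alpha v_T has the same pairing with [It] as v. *)
pose f : 'Hom(V, subvs_of U) := (U_part + ((alpha \o T_part) + (alpha \o T_part)))%VF.
have fE v : f v = U_part v + alpha (T_part v) *+ 2.
  by rewrite /f add_lfunE add_lfunE [(alpha \o T_part)%VF v]comp_lfunE.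
have [s [s_free sE]] := fg_subgroup_basis (@fg_subgroup_image _ _ f L fgL).
(* [f] is the identity on [U] and sends [L] into [I], so [I] is exactly the image of [L]. *)
have IE : latI U L = Zspan s.
  rewrite -sE; apply/seteqP; split=> [u Lu|_ [l Ll <-]].
    by exists (vsval u) => //; rewrite [LHS]fE U_part_U T_part_U linear0 mul0rn addr0.
  rewrite /latI /mkset; have -> : vsval (f l) = vsval (U_part l + alpha (T_part l) *+ 2).
    by rewrite fE.
  apply: lattice_U => t It_t; rewrite vsvalD formDl U_partE.
  have -> : b (l - vsval (T_part l)) (vsval t) + b (vsval (alpha (T_part l) *+ 2)) (vsval t) =
      b l (vsval t).
    rewrite formDl formNl form_TT vsvalMn [b (_ *+ 2) _]formMl [b (vsval (alpha _)) _]formC.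
    by rewrite alpha_sym subrK.
  by rewrite formC; apply: It_dual.
exists s; split=> //; apply/eqP; rewrite eqEsubv subvf; apply/subvP => u _.
have [n n0] := lattice_pos_multiple (vsval u); rewrite -vsvalMn => Lun.
have : Zspan s (u *+ n) by rewrite -IE.
by move=> /Zspan_span; rewrite -scaler_nat rpredZeq pnatr_eq0 eqn0Ngt n0.
Qed.

Lemma latI_det (M : 'End(subvs_of U)) :
  M @` latI U L = latI U L -> lfun_det M = 1 \/ lfun_det M = -1.
Proof.
have [s [s_free -> s_full]] := latI_basis; exact: lfun_det_lattice.
Qed.

Lemma Lambda_automorphismP gamma : O_Q (redform b U : {symmetric W}) gamma ->
  (gamma @` redlattice b U L = redlattice b U L /\
   forall x, dual_lattice (redform b U : {symmetric W}) (redlattice b U L) x ->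
     redlattice b U L (gamma x - x)) <->
  (forall w, Lambda_dual w -> L (vsval (tilde_WW Ut gamma w - w))).
Proof.
move=> gO.
have eq w : L (vsval (tilde_WW Ut gamma w - w)) <->
    redlattice b U L (gamma (idW w) - idW w).
  have -> : gamma (idW w) - idW w = idW (tilde_WW Ut gamma w - w).
    by rewrite linearB /= tgammaE.
  by split=> /lattice_idW.
have LaB x y : redlattice b U L x -> redlattice b U L y -> redlattice b U L (x - y).
  move=> /redlattice_idW[w -> Lw] /redlattice_idW[w' -> Lw'].
  by rewrite -linearB; apply/lattice_idW; rewrite vsvalB; apply: lattice_sub.
have LaD x : redlattice b U L x ->
    dual_lattice (redform b U : {symmetric W}) (redlattice b U L) x.
  move=> /redlattice_idW[w -> Lw]; apply/dual_lattice_idW => w' Lw'.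
  exact: even_lattice_int Lev Lw Lw'.
apply: iff_trans (isometry_latticeP redform_nondegenerate LaB LaD gO) _.
split=> [h w wL|h x]; first by apply/eq/h/dual_lattice_idW.
by rewrite -(idW_VK x) => /dual_lattice_idW/h/eq.
Qed.

Lemma param_image A M (gamma : 'End(W)) (psi : 'Hom(W, subvs_of U)) eta :
  has_parameters alpha A M gamma psi eta -> (A @: U)%VS = U.
Proof.
move=> Apar; apply/eqP; rewrite eqEsubv; apply/andP; split; apply/subvP => v.
  by move=> /memv_imgP[u uU ->]; rewrite -(vsprojK uU) (param_U Apar) subvsP.
move=> vU; apply/memv_imgP; exists (vsval (M^-1%VF (vsproj U v))); first exact: subvsP.
by rewrite (param_U Apar) (param_MVK (param_M0 Apar)) vsprojK.
Qed.

Lemma P0_R_SOplus (R : realType) (g : 'M[R]_(\dim {:V})) : P0_R b U g -> SOplus_R b g.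
Proof.
move=> [C [C1 CP Cc] Cg]; exists C => //; split=> // h /CP; by case.
Qed.

Lemma Gamma_stabP (R : realType) A M (gamma : 'End(W)) (psi : 'Hom(W, subvs_of U)) eta :
    P0_Q R b U A -> has_parameters alpha A M gamma psi eta ->
  Gamma_stab R b L U A <->
  [/\ Gamma R (redform b U) (redlattice b U L) gamma,
      SLrel (latI_dualL b U L) (latI U L) M,
      condition_psi Ut L It M psi &
      condition_eta alpha L M psi eta].
Proof.
move=> [[AO AU] AR] Apar; have gO := param_gamma Apar.
split=> [[_ [_ AL _ Adual]]|[[_ gL _ gdual] [[MI _] MJ] psiP etaP]].
  have [gL MI MJ psiP etaP] := core_forward Apar AO AL Adual.
  have [gL1 gL2] := (Lambda_automorphismP gO).2 gL.
  split.
  - by split=> //; apply: param_SOplus Apar AR.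
  (* The determinant is 1 or -1 because [M] preserves [I]; lying in the identity component makes it
     positive. *)
  - split=> //; split=> //; case: (latI_det MI) => // d.
    by have := param_det_gt0 Apar AR; rewrite d ltr0N1.
  - exact/condition_psiP.
  - exact/condition_etaP.
split=> //.
have [AL Adual] : A @` L = L /\ forall v, Ld v -> L (A v - v).
  apply/(isometry_latticeP ndeg lattice_sub lattice_dual AO).
  apply: (core_backward Apar _ MI).
  - exact/(Lambda_automorphismP gO).
  - exact/condition_psiP.
  - exact/condition_etaP.
by split=> //; apply: P0_R_SOplus.
Qed.

(** Precomposing [A] with [E], which is gamma'^-1 gamma on [Wt] and trivial on [U] and [Ut], changes
    the parameter [gamma'] alone. Conditions (ii)-(iv) do not mention it, so they pass from [A] to
    [A'] through [Gamma_stabP]. *)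
Lemma change_gamma (R : realType) A M (gamma gamma' : 'End(W))
    (psi : 'Hom(W, subvs_of U)) eta :
    Gamma R (redform b U) (redlattice b U L) gamma ->
    Gamma_stab R b L U A -> has_parameters alpha A M gamma' psi eta ->
  exists2 A', Gamma_stab R b L U A' & has_parameters alpha A' M gamma psi eta.
Proof.
move=> gG AG Apar; have [AR [AO AL _ Adual]] := AG.
have [gO gL gS gdual] := gG; have g'O := param_gamma Apar.
have [g'K g'VK] := isometry_bij redform_nondegenerate g'O.
have g'VO : O_Q (redform b U : {symmetric W}) gamma'^-1%VF.
  by move=> x y; rewrite -(g'O (gamma'^-1%VF x)) !g'VK.
pose h := (gamma'^-1 \o gamma)%VF.
pose iU := linfun (@vsval _ _ U); pose iT := linfun (@vsval _ _ Ut).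
pose iW := (linfun (@vsval _ _ Wt) \o idW^-1)%VF.
pose E : 'End(V) :=
  ((iU \o U_part) + (iT \o T_part) + (iW \o (h \o (idW \o W_part))))%VF.
have EE v : E v = vsval (U_part v) + vsval (T_part v) + vsval (tilde_WW Ut h (W_part v)).
  by rewrite /E add_lfunE pUTE [X in _ + X]comp_lfunE embed_WE [X in idW^-1%VF X]comp_lfunE rW'E tilde_WWE.
have hO : O_Q (redform b U : {symmetric W}) h.
  by move=> x y; rewrite /h !comp_lfunE g'VO gO.
have EO : O_Q b E.
  move=> x y; rewrite !EE [in RHS](decomp x) [in RHS](decomp y) !formE.
  rewrite !form_UW !form_TW !form_WU !form_WT -!form_idW !tgammaE hO.
  by ring.
have EU u : E (vsval u) = vsval u.
  by rewrite EE U_part_U T_part_U W_part_U !linear0 !addr0.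
have ET t : E (vsval t) = vsval t.
  by rewrite EE U_part_T T_part_T W_part_T !linear0 addr0 add0r.
have EW w : E (vsval w) = vsval (tilde_WW Ut h w).
  by rewrite EE U_part_W T_part_W W_part_W !linear0 !add0r.
pose A' : 'End(V) := (A \o E)%VF.
have A'par : has_parameters alpha A' M gamma psi eta.
  case: Apar => -[M0 _ eta_anti] [AU AW AT]; split; split=> //.
  - by move=> u; rewrite comp_lfunE EU AU.
  - move=> w; rewrite comp_lfunE EW AW.
    suff -> : tilde_WW Ut gamma' (tilde_WW Ut h w) = tilde_WW Ut gamma w by [].
    by apply: (can_inj idW_K); rewrite !tgammaE /h comp_lfunE g'VK.
  - by move=> t; rewrite comp_lfunE ET AT.
have A'R : P0_R b U (real_mx R A').
  have -> : real_mx R A' =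
      real_embed (rmx R gamma *m rmx R gamma'^-1%VF) *m real_mx R A.
    rewrite /real_embed -(rmx_comp R gamma) -2!rmx_comp -rmxD -rmx_comp.
    by [].
  apply: (P0_R_embed AR (param_SOplus Apar AR) gS).
    by move=> k kO; apply: O_R_mul kO _; apply: O_R_rmx.
  by rewrite -rmx_comp -rmx1; congr (rmx R _); apply/lfunP => x; rewrite comp_lfunE g'K id_lfunE.
exists A' => //; apply/(Gamma_stabP _ A'par).
  split=> //; split; first by move=> x y; rewrite !comp_lfunE AO EO.
  exact: param_image A'par.
have A0 : P0_Q R b U A.
  by split=> //; split=> //; apply: param_image Apar.
have [_ SLM psiP etaP] := (Gamma_stabP A0 Apar).1 AG.
by split.
Qed.

End Decomposition.

Theorem proposition3p2 (R : realType) (V : vectType rat) (b : {symmetric V})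
    (b_nondegenerate : nondegenerate b)
    (L : set V) (L_even : even_lattice b L)
    (U : {vspace V}) (U_isotropic : (U <= orthov b U)%VS)
    (It : set V) (It_fg : fg_subgroup It) (It_dual : It `<=` dual_lattice b L)
    (It_unimodular : unimodular_pairing b U L It)
    (Ut : {vspace V}) (Ut_def : Ut = Qspan It)
    (alpha : 'Hom(subvs_of Ut, subvs_of U)) (alpha_def : is_alpha b alpha) :
  let I := latI U L in
  let J := latI_dualL b U L in
  let Lambda := redlattice b U L in
  let Gamma_Lambda := Gamma R (redform b U) Lambda in
  [/\ forall (A : 'End(V)) (M : 'End(subvs_of U)) (gamma : 'End(redspace b U))
        (psi : 'Hom(redspace b U, subvs_of U))
        (eta : 'Hom(dualv (subvs_of U), subvs_of U)),
        P0_Q R b U A -> has_parameters alpha A M gamma psi eta ->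
        Gamma_stab R b L U A <->
        [/\ Gamma_Lambda gamma,
            SLrel J I M,
            condition_psi Ut L It M psi &
            condition_eta alpha L M psi eta],
      forall gamma : 'End(redspace b U), Gamma_Lambda gamma ->
        forall (A : 'End(V)) (M : 'End(subvs_of U)) (gamma' : 'End(redspace b U))
          (psi : 'Hom(redspace b U, subvs_of U))
          (eta : 'Hom(dualv (subvs_of U), subvs_of U)),
          Gamma_stab R b L U A -> has_parameters alpha A M gamma' psi eta ->
          exists2 A', Gamma_stab R b L U A' &
            has_parameters alpha A' M gamma psi eta,
      forall M : 'End(subvs_of U), SLrel J I M ->
        exists psi : 'Hom(redspace b U, subvs_of U), condition_psi Ut L It M psi &
      forall (M : 'End(subvs_of U)) (psi : 'Hom(redspace b U, subvs_of U)),
        SLrel J I M -> condition_psi Ut L It M psi ->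
        exists2 eta : 'Hom(dualv (subvs_of U), subvs_of U),
          antisymmetric_map eta /\ condition_eta alpha L M psi eta &
          forall eta', antisymmetric_map eta' /\ condition_eta alpha L M psi eta' <->
            antisymmetric_map (eta' - eta) /\ HomI U L (eta' - eta)].
Proof.
split.
- move=> A M gamma psi eta AP Apar.
  exact: (Gamma_stabP b_nondegenerate L_even U_isotropic It_fg It_dual
            It_unimodular Ut_def alpha_def AP Apar).
- move=> gamma gammaG A M gamma' psi eta AG Apar.
  exact: (change_gamma b_nondegenerate L_even U_isotropic It_fg It_dual
            It_unimodular Ut_def alpha_def gammaG AG Apar).
- move=> M [_ MJ].
  have [psi psiP] := psi_exists b_nondegenerate L_even U_isotropic It_fg It_dual
    It_unimodular Ut_def MJ.
  by exists psi; apply/(condition_psiP b_nondegenerate L_even U_isotropic It_fg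
    It_dual It_unimodular Ut_def).
move=> M psi [_ MJ] /(condition_psiP b_nondegenerate L_even U_isotropic It_fg
  It_dual It_unimodular Ut_def _ MJ) psiP.
have [eta [eta_anti etaP]] := eta_exists b_nondegenerate L_even U_isotropic It_fg
  It_dual It_unimodular Ut_def alpha_def psiP.
have eta_cond : condition_eta alpha L M psi eta.
  exact/(condition_etaP b_nondegenerate It_fg It_dual It_unimodular Ut_def).
exists eta => //.
exact: (eta_difference b_nondegenerate L_even It_fg It_dual It_unimodular Ut_def
          eta_anti eta_cond).
Qed.
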